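(* Let $\nu>0$, and let $f=f(x,t)\ge 0$, $x\in\mathbb{R}$, $t\ge 0$, be a sufficiently smooth time-dependent density with $\int_{-\infty}^\infty f(x,t)\,dx=1$ for all $t$ and with zero boundary conditions at $x=\pm\infty$. Define $$g(x,t)=\int_{-\infty}^\infty e^{-|z|/\nu} f(x-z,t)\,dz,\qquad h(x,t)=\int_{-\infty}^\infty z\,e^{-|z|/\nu} f(x-z,t)\,dz ,$$ assume that $h_x$ and $g$ vanish at $x=-\infty$, and assume that $f$ satisfies $$f_t=\left(\frac{h}{g}\,f\right)_x .$$ Then $$\frac{d}{dt}\,\|g\|_{L^2}^2=\frac{2}{\nu}\int_{-\infty}^\infty\frac{h^2(x,t)}{g(x,t)}\,f(x,t)\,dx ,$$ and therefore $$\frac{d}{dt}\,\|g\|_{L^2}^2>0 .$$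
   Context: Subscripts $x$ and $t$ denote partial derivatives, and $\|g\|_{L^2}$ is the $L^2(\mathbb{R})$-norm of $g(\cdot,t)$ with respect to $x$. The function $f(x,t)$ is the density of opinion holders on the real line at time $t$, evolving under a continuous analogue of Hegselmann-Krause opinion dynamics with interaction function $e^{-z/\nu}$; $g$ is called the locally averaged opinion holder density. Positivity of $f$ implies positivity of $g$. Since $\int_{-\infty}^\infty g(x,t)\,dx=2\nu$ for all $t$, one has $\|g\|_{L^2}^2=2\nu\,E(g(X))$ for a random number $X$ with probability density $g/(2\nu)$, so the result says that $g$ becomes increasingly concentrated. ''Sufficiently smooth'' means smooth enough for differentiating under the integral sign and integrating by parts. *)

(* Defs.v *)
From HB Require Import structures.
From mathcomp Require Import all_boot all_order all_algebra.
From mathcomp Require Import all_classical all_reals all_analysis.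

Set Implicit Arguments.
Unset Strict Implicit.
Unset Printing Implicit Defensive.
Import Order.TTheory GRing.Theory Num.Theory.
Import numFieldNormedType.Exports.

Local Open Scope classical_set_scope.
Local Open Scope ring_scope.

(* A function of space and time is a map [f : R -> R -> R], written [f x t]. It
   is only meaningful for [0 <= t]: nothing below depends on its values at
   negative times. *)

(* Derivative of a function of time on [0, +oo[: the usual two-sided derivative
   at t > 0 and the right derivative at t = 0. *)
Definition time_quotient (R : realType) (u : R -> R) (t : R) : set_system R :=
  (fun s : R => (u s - u t) / (s - t)) @ within [set s : R | 0 <= s] t^'.

Definition time_derivable (R : realType) (u : R -> R) (t : R) : Prop :=
  cvg (time_quotient u t).

Definition time_derive (R : realType) (u : R -> R) (t : R) : R :=
  lim (time_quotient u t).

(* Regularity in the sense of "smooth enough for differentiating under the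
   integral sign and integrating by parts": f is continuously differentiable in
   x, differentiable in t, and, locally uniformly in time, its time derivative
   is dominated by a function integrable over space. *)
Definition sufficiently_smooth (R : realType) (f : R -> R -> R) : Prop :=
  [/\ forall t x : R, 0 <= t -> derivable (fun y : R => f y t) x 1,
      forall t : R, 0 <= t -> continuous (derive1 (fun y : R => f y t)),
      forall t x : R, 0 <= t -> time_derivable (f x) t
    & forall t : R, 0 <= t -> exists (e : R) (G : R -> R),
        [/\ 0 < e,
            (@lebesgue_measure R).-integrable setT (EFin \o G)
          & forall s x : R, 0 <= s -> `|s - t| < e ->
              `|time_derive (f x) s| <= G x]].

(* The two convolutions below are real-valued Lebesgue integrals; they converge
   as soon as [f^~ t] is integrable, both kernels being bounded. *)
Definition local_average (R : realType) (nu : R) (f : R -> R -> R) (x t : R)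
    : R :=
  \int[@lebesgue_measure R]_z (expR (- (`|z| / nu)) * f (x - z) t).

Definition local_moment (R : realType) (nu : R) (f : R -> R -> R) (x t : R)
    : R :=
  \int[@lebesgue_measure R]_z (z * expR (- (`|z| / nu)) * f (x - z) t).

(* [fine] loses nothing for the functions [g^~ t] of the theorem: they are
   bounded and integrable, hence square integrable. *)
Definition L2norm (R : realType) (u : R -> R) : R :=
  fine (Lnorm (@lebesgue_measure R) 2%:E (EFin \o u)).

(* Main.v *)
Require Import Defs.
From HB Require Import structures.
From mathcomp Require Import all_boot all_order all_algebra.
From mathcomp Require Import all_classical all_reals all_analysis.
From mathcomp Require Import measurable_realfun ring lra.

Set Implicit Arguments.
Unset Strict Implicit.
Unset Printing Implicit Defensive.
Import Order.TTheory GRing.Theory Num.Theory.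
Import numFieldNormedType.Exports.

Local Open Scope classical_set_scope.
Local Open Scope ring_scope.

(** Write [k z = exp (- |z| / nu)], [m z = z k z] and [K z = (nu + |z|) k z]. For a
    density [p] on the line put [g = k * p], [h = m * p] and [phi = K * p]
    (convolutions). Two facts about these kernels carry the proof: [K] is the
    convolution of [k] with itself, and [K' = - m / nu].

    By the first one (lemmas [avg_kernel_self_conv] and
    [integral_sqr_local_density]) the squared norm of [g] is the pair energy, the
    integral of [phi p], a quadratic form in [p]. Since this form is symmetric, its
    time derivative along [f] is twice the integral of [phi f_t]
    ([energy_difference], [energy_time_derivative]). Now [f_t] is the derivative of
    the flux [w = h p / g], and by the second fact [phi' = - h / nu], so that
    integration by parts turns the integral of [phi w'] into that of
    [h ^ 2 p / (nu g)] ([flux_dissipation]).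

    The boundary terms of this integration by parts are the delicate point, because
    [h / g] need not be bounded. It grows at most linearly
    ([norm_local_moment_le]), and a cutoff on a scale tending to infinity then
    suffices, since a density loses its mass far away ([integral_by_cutoff]).

    The integral of [h ^ 2 p / g] is positive ([dissipation_gt0]) because otherwise
    [h] would vanish where [p] does not, whereas the interaction strictly pulls
    mass together: tested against an increasing function, [h p] has an integral of
    a strict sign, by oddness of [m]. *)

(** * Integration on the line: domination, reflection, Fubini *)

Lemma integrable_bound (R : realType) (f G : R -> R) :
  measurable_fun setT f ->
  (@lebesgue_measure R).-integrable setT (EFin \o G) ->
  (forall x, `|f x| <= G x) ->
  (@lebesgue_measure R).-integrable setT (EFin \o f).
Proof.
move=> mf iG fG; apply: le_integrable iG => //.
  exact/measurable_EFinP.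
by move=> x _; rewrite /= lee_fin (le_trans (fG x))// ler_norm.
Qed.

Lemma integrable_scale (R : realType) (c : R) (f : R -> R) :
  (@lebesgue_measure R).-integrable setT (EFin \o f) ->
  (@lebesgue_measure R).-integrable setT (EFin \o (fun x => c * f x)).
Proof.
move=> intf; have := integrableZl measurableT c intf.
by apply: eq_integrable => // x _; rewrite /= EFinM.
Qed.

Lemma integrable_add (R : realType) (f g : R -> R) :
  (@lebesgue_measure R).-integrable setT (EFin \o f) ->
  (@lebesgue_measure R).-integrable setT (EFin \o g) ->
  (@lebesgue_measure R).-integrable setT (EFin \o (fun x => f x + g x)).
Proof.
move=> intf intg; have := integrableD measurableT intf intg.
by apply: eq_integrable => // x _; rewrite /= EFinD.
Qed.

Lemma integrable_sub (R : realType) (f g : R -> R) :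
  (@lebesgue_measure R).-integrable setT (EFin \o f) ->
  (@lebesgue_measure R).-integrable setT (EFin \o g) ->
  (@lebesgue_measure R).-integrable setT (EFin \o (fun x => f x - g x)).
Proof.
move=> intf intg; have := integrableB measurableT intf intg.
by apply: eq_integrable => // x _; rewrite /= EFinB.
Qed.

(** Every kernel below is bounded, so this is what makes its convolutions converge. *)
Lemma integrable_bounded_mul (R : realType) (k f : R -> R) (C : R) :
  measurable_fun setT k -> (forall x, `|k x| <= C) ->
  (@lebesgue_measure R).-integrable setT (EFin \o f) ->
  (@lebesgue_measure R).-integrable setT (EFin \o (fun x => k x * f x)).
Proof.
move=> mk kC intf.
have mf : measurable_fun setT f by apply/measurable_EFinP; apply: measurable_int intf.
apply: (@integrable_bound _ _ (fun x => C * `|f x|)).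
- exact: measurable_funM.
- exact: integrable_scale (integrable_norm intf).
- by move=> x; rewrite normrM ler_wpM2r.
Qed.

(** Dominated convergence is a statement about sequences. The filter of punctured
    neighbourhoods of [a] within [D] has a countable basis, so it extends to that
    filter: if convergence failed, points [x n] of [D] closer and closer to [a]
    would keep the integrals a fixed distance away from the limit. The point [c]
    where pointwise convergence may fail is the corner of a kernel. Taking [D]
    everything gives derivatives in space; taking the half-line gives the
    derivative in time, one-sided at time 0. *)
Lemma dominated_within (R : realType) (D : set R) (a c : R)
    (Phi : R -> R -> R) (Phi0 G : R -> R) :
  (forall s, D s -> s != a -> measurable_fun setT (Phi s)) ->
  measurable_fun setT Phi0 ->
  (@lebesgue_measure R).-integrable setT (EFin \o G) ->
  (\forall s \near within D a^', forall y, `|Phi s y| <= G y) ->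
  (forall y, y != c -> Phi s y @[s --> within D a^'] --> Phi0 y) ->
  \int[@lebesgue_measure R]_y Phi s y @[s --> within D a^'] -->
  \int[@lebesgue_measure R]_y Phi0 y.
Proof.
move=> mPhi mPhi0 iG bPhi cPhi.
apply: contrapT => ncv.
(* The failure of convergence gives bad points at every scale [d]. *)
have [e He] : exists e : {posnum R}, forall d : {posnum R},
    exists s, [/\ D s, s != a, `|s - a| < d%:num &
      `|\int[@lebesgue_measure R]_y Phi s y - \int[@lebesgue_measure R]_y Phi0 y| >= e%:num].
  apply: contrapT; apply: contra_not ncv => /forallNP h.
  apply/cvgrPdist_lt => e e0; have /existsNP[d] := h (PosNum e0).
  move/forallNP => {}h.
  exists d%:num => //= s /= sd sa Ds.
  rewrite distrC ltNge; apply/negP => es; apply: (h s); split => //=.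
  by rewrite distrC.
have {}bPhi : exists2 d : {posnum R}, True & forall s, D s -> s != a ->
    `|s - a| < d%:num -> forall y, `|Phi s y| <= G y.
  move: bPhi => [d /= d0 bPhi]; exists (PosNum d0) => // s Ds sa sd.
  by apply: bPhi => //=; rewrite distrC.
have [d0 _ {}bPhi] := bPhi.
have invn n : 0 < Num.min d0%:num n.+1%:R^-1 by rewrite lt_min invr_gt0 ltr0n andbT.
pose x n := sval (cid (He (PosNum (invn n)))).
have [xD xa xda xe] : [/\ forall n, D (x n), forall n, x n != a,
    forall n, `|x n - a| < Num.min d0%:num n.+1%:R^-1 &
    forall n, e%:num <= `|\int[@lebesgue_measure R]_y Phi (x n) y -
        \int[@lebesgue_measure R]_y Phi0 y| ].
  by split => n; rewrite /x; case: cid => s [].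
have xcv : x n @[n --> \oo] --> within D a^'.
  move=> A [r /= r0 rA].
  suff : \forall n \near \oo, A (x n) by [].
  near=> n; apply: (rA (x n)) => //=.
  rewrite distrC (lt_le_trans (xda n))// ge_min; apply/orP; right.
  rewrite -(invrK r) lef_pV2 ?posrE ?invr_gt0//.
  near: n; exists (Num.truncn r^-1) => // s /= rs.
  by apply/ltW; rewrite -truncn_le_nat.
have [] := @dominated_convergence _ _ _ (@lebesgue_measure R) _ measurableT
  (fun n => EFin \o Phi (x n)) (EFin \o Phi0) (EFin \o G).
- by move=> n; apply/measurable_EFinP; exact: mPhi.
- exact/measurable_EFinP.
- exists [set c]; split; [exact: measurable_set1|exact: lebesgue_measure_set1|].
  move=> y /=; apply: contra_notP => /eqP yc _.
  apply/cvg_EFin; first by apply: nearW.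
  exact: cvg_comp xcv (cPhi y yc).
- exact: iG.
- apply: aeW => y n _ /=; rewrite lee_fin; apply: bPhi => //.
  by rewrite (lt_le_trans (xda n))// ge_min lexx.
move=> iPhi0 _ cv.
have {}cv : \int[@lebesgue_measure R]_y Phi (x n) y @[n --> \oo] -->
    \int[@lebesgue_measure R]_y Phi0 y.
  apply: fine_cvg; rewrite fineK//.
  exact: integrable_fin_num.
move/cvgrPdist_lt : cv => /(_ e%:num (ltac:(by []))) [N _ /(_ N (leqnn _))].
by rewrite distrC ltNge xe.
Unshelve. all: by end_near. Qed.

Lemma lebesgue_measure_reflection (R : realType) (c : R) (A : set R) :
  measurable A ->
  pushforward (@lebesgue_measure R)
    ((fun z => c - z) : _ -> measurableTypeR R) A = @lebesgue_measure R A.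
Proof.
have mc : measurable_fun setT ((fun z => c - z) : measurableTypeR R -> measurableTypeR R).
  by apply: measurable_funB.
move=> mA; apply/esym.
apply: (@lebesgue_measure_unique _ (pushforward (@lebesgue_measure R) ((fun z => c - z) :
    _ -> measurableTypeR R))) => //= _ [[a b]] _ <-.
rewrite /pushforward.
rewrite (_ : _ @^-1` _ = [set` `[c - b, c - a[ ]); last first.
  by apply/seteqP; split => z /=; rewrite !in_itv/=; lra.
rewrite !lebesgue_measure_itv/= !lte_fin.
have -> : (c - b < c - a) = (a < b) by apply/idP/idP; lra.
by case: ifP => // _; rewrite -!EFinB; congr EFin; ring.
Qed.

(** Lebesgue measure is invariant under every reflection of the line, which turns
    the convolutions of the statement, with [p (x - z)], into ones with
    [k (x - y)], where the variable [x] can be differentiated in the kernel. *)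
Lemma integral_reflection (R : realType) (c : R) (F : R -> \bar R) :
  measurable_fun setT F -> (forall x, 0 <= F x)%E ->
  (\int[@lebesgue_measure R]_z F (c - z)%R = \int[@lebesgue_measure R]_z F z)%E.
Proof.
move=> mF F0.
have mc : measurable_fun setT ((fun z => c - z) : measurableTypeR R -> measurableTypeR R).
  by apply: measurable_funB.
have := @ge0_integral_pushforward _ _ _ _ _ _ mc (@lebesgue_measure R) setT F measurableT mF.
rewrite preimage_setT => <-//.
apply: eq_measure_integral => //= A mA _; exact: lebesgue_measure_reflection.
Qed.

Lemma Rintegral_reflection (R : realType) (c : R) (F : R -> R) :
  measurable_fun setT F ->
  \int[@lebesgue_measure R]_z F (c - z) = \int[@lebesgue_measure R]_z F z.
Proof.
move=> mF; rewrite /Rintegral integralE [in RHS]integralE; congr (fine (_ - _)%E).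
- rewrite -[RHS](integral_reflection c)//.
  - by apply: eq_integral => z _; rewrite !funeposE.
  - exact/measurable_funepos/measurable_EFinP.
- rewrite -[RHS](integral_reflection c)//.
  - by apply: eq_integral => z _; rewrite !funenegE.
  - exact/measurable_funeneg/measurable_EFinP.
Qed.

(** Boundedness of the kernel dominates the integrand by a product of two
    integrable functions of one variable. *)
Lemma Fubini_bounded_kernel (R : realType) (P : R * R -> R) (u v : R -> R) (C : R) :
  measurable_fun setT P -> (forall z, `|P z| <= C) ->
  (@lebesgue_measure R).-integrable setT (EFin \o u) ->
  (@lebesgue_measure R).-integrable setT (EFin \o v) ->
  \int[@lebesgue_measure R]_x (u x * \int[@lebesgue_measure R]_y (P (x, y) * v y)) =
  \int[@lebesgue_measure R]_y (v y * \int[@lebesgue_measure R]_x (P (x, y) * u x)).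
Proof.
move=> mP PC iu iv.
have mu : measurable_fun setT u by apply/measurable_EFinP; apply: measurable_int iu.
have mv : measurable_fun setT v by apply/measurable_EFinP; apply: measurable_int iv.
pose f (z : R * R) : \bar R := (u z.1 * P z * v z.2)%:E.
have mf : measurable_fun setT f.
  apply/measurable_EFinP; apply: measurable_funM; last exact: measurableT_comp.
  by apply: measurable_funM => //; exact: measurableT_comp.
have iPv x : (@lebesgue_measure R).-integrable setT (EFin \o (fun y => P (x, y) * v y)).
  apply: (@integrable_bounded_mul _ _ _ C) => //.
  exact: measurableT_comp mP (measurable_pair1 x).
have iPu y : (@lebesgue_measure R).-integrable setT (EFin \o (fun x => P (x, y) * u x)).
  apply: (@integrable_bounded_mul _ _ _ C) => //.
  exact: measurableT_comp mP (measurable_pair2 y).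
have iF : (@lebesgue_measure R \x @lebesgue_measure R)%E.-integrable setT f.
  apply/integrable12ltyP => //.
  have C0 : 0 <= C by exact: le_trans (PC (0, 0)).
  have iV := integrable_fin_num measurableT (integrable_norm iv).
  have iU := integrable_fin_num measurableT (integrable_norm iu).
  apply: (@le_lt_trans _ _ (\int[@lebesgue_measure R]_x (`|u x|%:E * (C%:E *
      \int[@lebesgue_measure R]_y `|v y|%:E)))%E).
    apply: ge0_le_integral => //=.
    - by move=> x _; exact: integral_ge0.
    - apply: (@measurable_fun_fubini_tonelli_F _ _ _ _ R (@lebesgue_measure R) (abse \o
        f)) => //=.
      exact: measurableT_comp.
    - apply: emeasurable_funM => //; apply/measurable_EFinP.
      exact: measurableT_comp.
    - move=> x _; rewrite -!ge0_integralZl//=.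
      + apply: ge0_le_integral => //=.
        * apply/measurable_EFinP; apply: measurableT_comp => //.
          apply: measurable_funM => //; apply: measurable_funM => //.
          exact: measurableT_comp mP (measurable_pair1 x).
        * apply: emeasurable_funM => //; apply: emeasurable_funM => //.
          by apply/measurable_EFinP; exact: measurableT_comp.
        * move=> y _; rewrite -!EFinM lee_fin !normrM -mulrA ler_wpM2l//.
          by rewrite ler_wpM2r.
      + apply: emeasurable_funM => //.
        by apply/measurable_EFinP; exact: measurableT_comp.
      + by move=> y _; rewrite mule_ge0.
      + by apply/measurable_EFinP; exact: measurableT_comp.
  rewrite ge0_integralZr//=; last 2 first.
  - by apply/measurable_EFinP; exact: measurableT_comp.
  - by rewrite mule_ge0// integral_ge0.
  by rewrite ltey_eq !fin_numM.
rewrite /Rintegral; congr fine.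
transitivity (\int[@lebesgue_measure R]_x fubini_F (@lebesgue_measure R) f x)%E.
  apply: eq_integral => x _; rewrite /fubini_F /f/=.
  under [RHS]eq_integral do rewrite -mulrA EFinM.
  rewrite integralZl//; last exact: iPv.
  by rewrite -[X in _ = (_ * X)%E]fineK//; exact: (integrable_fin_num measurableT (iPv x)).
rewrite integral12_prod_meas1// -integral21_prod_meas1//.
apply: eq_integral => y _; rewrite /fubini_G /f/=.
under eq_integral do rewrite mulrC (mulrC (u _)) EFinM.
rewrite integralZl//; last exact: iPu.
by rewrite -[X in (_ * X = _)%E]fineK//; exact: (integrable_fin_num measurableT (iPu y)).
Qed.

(** * Derivatives and convolution with a cornered kernel *)

(** These rules are stated pointwise because this is the form that unifies with
    the expressions below. *)
Lemma is_derive_add (R : realType) (f g : R -> R) (x df dg : R) :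
  is_derive x (1 : R) f df -> is_derive x (1 : R) g dg ->
  is_derive x (1 : R) (fun y => f y + g y) (df + dg).
Proof. by move=> ? ?; exact: is_deriveD. Qed.

Lemma is_derive_mul (R : realType) (f g : R -> R) (x df dg : R) :
  is_derive x (1 : R) f df -> is_derive x (1 : R) g dg ->
  is_derive x (1 : R) (fun y => f y * g y) (df * g x + f x * dg).
Proof.
move=> df_ dg_; have := is_deriveM df_ dg_.
by rewrite /GRing.scale/= addrC (mulrC (g x)).
Qed.

Lemma is_derive_inv (R : realType) (f : R -> R) (x df : R) :
  f x != 0 -> is_derive x (1 : R) f df ->
  is_derive x (1 : R) (fun y => (f y)^-1) (- df / f x ^+ 2).
Proof.
move=> fx0 dfx; have := is_deriveV fx0 dfx.
by rewrite /GRing.scale/= mulNr mulrC -mulNr.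
Qed.

Lemma is_derive_expR_comp (R : realType) (f : R -> R) (x df : R) :
  is_derive x (1 : R) f df ->
  is_derive x (1 : R) (fun y => expR (f y)) (df * expR (f x)).
Proof.
move=> dfx; have := @is_derive1_comp R expR f x (expR (f x)) df _ dfx.
by rewrite mulrC; apply; exact: is_derive_expR.
Qed.

Lemma is_derive_continuous (R : realType) (f : R -> R) (x df : R) :
  is_derive x (1 : R) f df -> {for x, continuous f}.
Proof. by move=> [dfx _]; apply/differentiable_continuous/derivable1_diffP. Qed.

(** A corner of the kernel at 0 is harmless for Lipschitz bounds: the mean value
    inequality applies on either side of it. *)
Lemma lipschitz_off0 (R : realType) (k k' : R -> R) (L : R) :
  continuous k -> (forall z, z != 0 -> is_derive z (1 : R) k (k' z)) ->
  (forall z, `|k' z| <= L) ->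
  forall a b, `|k b - k a| <= L * `|b - a|.
Proof.
move=> ck dk bk'.
have mvt a b : a <= b -> (0 <= a) || (b <= 0) -> `|k b - k a| <= L * `|b - a|.
  move=> ab ab0; have [||c _ ->] := @MVT_segment _ k k' a b ab.
  - move=> x; rewrite in_itv/= => /andP[ax xb]; apply: dk.
    by case/orP: ab0 => ?; [rewrite gt_eqF//|rewrite lt_eqF//]; lra.
  - exact: continuous_subspaceT.
  - by rewrite normrM ler_wpM2r.
have ordered a b : a <= b -> `|k b - k a| <= L * `|b - a|.
  move=> ab; have [a0|a0] := leP 0 a; first by apply: mvt; rewrite ?a0.
  have [b0|b0] := leP b 0; first by apply: mvt; rewrite ?b0 ?orbT.
  have -> : k b - k a = (k b - k 0) + (k 0 - k a) by ring.
  rewrite (le_trans (ler_normD _ _))//.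
  have -> : L * `|b - a| = L * `|b - 0| + L * `|0 - a|.
    by rewrite !ger0_norm ?subr_ge0// ?(ltW a0)// ?(ltW b0)//; ring.
  by apply: lerD; apply: mvt; rewrite ?lexx ?orbT ?(ltW a0) ?(ltW b0).
move=> a b; have [ab|/ltW ba] := leP a b; first exact: ordered.
by rewrite distrC (distrC b); exact: ordered.
Qed.

Definition conv (R : realType) (k p : R -> R) (x : R) : R :=
  \int[@lebesgue_measure R]_y (k (x - y) * p y).

Lemma conv_reflection (R : realType) (k p : R -> R) (x : R) :
  measurable_fun setT k -> measurable_fun setT p ->
  \int[@lebesgue_measure R]_z (k z * p (x - z)) = conv k p x.
Proof.
move=> mk mp; rewrite -(Rintegral_reflection x).
  by congr Rintegral; apply/funext => z; rewrite subKr.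
apply: measurable_funM => //; apply: measurableT_comp => //.
exact: measurable_funB.
Qed.

Lemma measurable_translate (R : realType) (k : R -> R) (x : R) :
  measurable_fun setT k -> measurable_fun setT (fun y : R => k (x - y)).
Proof.
by move=> mk; apply: measurableT_comp => //; exact: measurable_funB.
Qed.

Lemma integrable_conv (R : realType) (k p : R -> R) (C x : R) :
  measurable_fun setT k -> (forall z, `|k z| <= C) ->
  (@lebesgue_measure R).-integrable setT (EFin \o p) ->
  (@lebesgue_measure R).-integrable setT (EFin \o (fun y => k (x - y) * p y)).
Proof.
move=> mk kC ip; apply: (@integrable_bounded_mul _ (fun y => k (x - y)) p C) => //.
exact: measurable_translate.
Qed.

(** For fixed [x], the discontinuity of the kernel at 0 is met only at the single
    point [y = x]. *)
Lemma conv_continuous (R : realType) (k p : R -> R) (C : R) :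
  measurable_fun setT k -> (forall z, `|k z| <= C) ->
  (forall z, z != 0 -> {for z, continuous k}) ->
  (@lebesgue_measure R).-integrable setT (EFin \o p) ->
  continuous (conv k p).
Proof.
move=> mk kC ck ip x; apply/continuous_withinNx.
have mp : measurable_fun setT p by apply/measurable_EFinP; apply: measurable_int ip.
suff : conv k p s @[s --> within setT x^'] --> conv k p x by rewrite withinET.
apply: (@dominated_within _ setT x x (fun s y => k (s - y) * p y)
  (fun y => k (x - y) * p y) (fun y => C * `|p y|)).
- by move=> s _ _; apply: measurable_funM => //; exact: measurable_translate.
- by apply: measurable_funM => //; exact: measurable_translate.
- exact: integrable_scale (integrable_norm ip).
- by apply: nearW => s y; rewrite normrM ler_wpM2r.
- move=> y yx; rewrite withinET; apply: cvgM; last exact: cvg_cst.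
  apply: (@cvg_comp _ _ _ (fun s => s - y) k _ (nbhs (x - y))).
    apply: cvg_within_filter.
    by apply: cvgB; [exact: cvg_id|exact: cvg_cst].
  by apply: ck; rewrite subr_eq0 eq_sym.
Qed.

(** The Lipschitz bound dominates the difference quotients of the kernel, which
    converge except at the single point [y = x]; the derivative falls entirely on
    the kernel. *)
Lemma conv_is_derive (R : realType) (k k' p : R -> R) (C C' : R) :
  continuous k -> (forall z, `|k z| <= C) ->
  (forall z, z != 0 -> is_derive z (1 : R) k (k' z)) ->
  measurable_fun setT k' -> (forall z, `|k' z| <= C') ->
  (@lebesgue_measure R).-integrable setT (EFin \o p) ->
  forall x, is_derive x (1 : R) (conv k p) (conv k' p x).
Proof.
move=> ck kC dk mk' k'C ip x.
have mk := continuous_measurable_fun ck.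
have mp : measurable_fun setT p by apply/measurable_EFinP; apply: measurable_int ip.
have lk := lipschitz_off0 ck dk k'C.
suff H : h^-1 *: (conv k p (h *: 1 + x) - conv k p x) @[h --> 0^'] --> conv k' p x.
  by apply: DeriveDef; [apply/cvg_ex; exists (conv k' p x)|apply/cvg_lim].
have E h : h^-1 *: (conv k p (h *: 1 + x) - conv k p x) =
    \int[@lebesgue_measure R]_y (h^-1 * (k (h + x - y) - k (x - y)) * p y).
  rewrite /GRing.scale/= mulr1 /conv -RintegralB//; [|exact: integrable_conv ip..].
  rewrite -RintegralZl//.
    by congr Rintegral; apply/funext => y; ring.
  exact: integrable_sub (integrable_conv (h + x) mk kC ip) (integrable_conv x mk kC ip).
under eq_fun do rewrite E.
suff : \int[@lebesgue_measure R]_y (h^-1 * (k (h + x - y) - k (x - y)) * p y)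
    @[h --> within setT 0^'] --> conv k' p x by rewrite withinET.
apply: (@dominated_within _ setT 0 x
  (fun h y => h^-1 * (k (h + x - y) - k (x - y)) * p y)
  (fun y => k' (x - y) * p y) (fun y => C' * `|p y|)).
- move=> s _ _; apply: measurable_funM => //; apply: measurable_funM => //.
  by apply: measurable_funB; exact: measurable_translate.
- by apply: measurable_funM => //; exact: measurable_translate.
- exact: integrable_scale (integrable_norm ip).
- rewrite withinET; near=> h => y; rewrite normrM ler_wpM2r//.
  have h0 : h != 0 by near: h; exact: nbhs_dnbhs_neq.
  rewrite normrM normfV mulrC ler_pdivrMr ?normr_gt0//.
  by rewrite (le_trans (lk _ _))//; have -> : h + x - y - (x - y) = h by ring.
- move=> y yx; rewrite withinET; apply: cvgM; last exact: cvg_cst.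
  have xy0 : x - y != 0 by rewrite subr_eq0 eq_sym.
  have [dk1 dk2] := dk _ xy0.
  rewrite -dk2.
  have : h^-1 *: ((k \o shift (x - y)) (h *: 1) - k (x - y)) @[h --> 0^'] --> 'D_1 k (x - y).
    exact: dk1.
  by under eq_fun do rewrite /GRing.scale/= mulr1 addrA.
Unshelve. all: by end_near. Qed.

(** * The averaging, moment and pair kernels *)

Definition avg_kernel (R : realType) (nu z : R) : R := expR (- (`|z| / nu)).
(** The value at 0, where the averaging kernel has a corner, is arbitrary. *)
Definition avg_kernel' (R : realType) (nu z : R) : R :=
  if 0 < z then - (avg_kernel nu z / nu) else avg_kernel nu z / nu.
Definition moment_kernel (R : realType) (nu z : R) : R := z * avg_kernel nu z.
Definition moment_kernel' (R : realType) (nu z : R) : R :=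
  (1 - `|z| / nu) * avg_kernel nu z.
(** This is the averaging kernel convolved with itself, see
    [avg_kernel_self_conv]. *)
Definition pair_kernel (R : realType) (nu z : R) : R :=
  (nu + `|z|) * avg_kernel nu z.
(** A multiple of the moment kernel: this identity brings [h] into the time
    derivative of the energy. *)
Definition pair_kernel' (R : realType) (nu z : R) : R :=
  - (moment_kernel nu z / nu).

Lemma avg_kernel_gt0 (R : realType) (nu z : R) : 0 < avg_kernel nu z.
Proof. exact: expR_gt0. Qed.

Lemma avg_kernel_le1 (R : realType) (nu z : R) : 0 < nu -> avg_kernel nu z <= 1.
Proof. by move=> nu0; rewrite expR_le1 oppr_le0 divr_ge0// ltW. Qed.

Lemma norm_avg_kernel (R : realType) (nu z : R) : 0 < nu -> `|avg_kernel nu z| <= 1.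
Proof. by move=> nu0; rewrite gtr0_norm ?avg_kernel_gt0// avg_kernel_le1. Qed.

Lemma avg_kernelN (R : realType) (nu z : R) : avg_kernel nu (- z) = avg_kernel nu z.
Proof. by rewrite /avg_kernel normrN. Qed.

Lemma moment_kernelN (R : realType) (nu z : R) :
  moment_kernel nu (- z) = - moment_kernel nu z.
Proof. by rewrite /moment_kernel avg_kernelN mulNr. Qed.

Lemma pair_kernelN (R : realType) (nu z : R) : pair_kernel nu (- z) = pair_kernel nu z.
Proof. by rewrite /pair_kernel avg_kernelN normrN. Qed.

Lemma add1_expRN_le1 (R : realType) (u : R) : (1 + u) * expR (- u) <= 1.
Proof. by rewrite expRN ler_pdivrMr ?expR_gt0// mul1r expR_ge1Dx. Qed.

Lemma norm_mul_avg_kernel (R : realType) (nu z : R) : 0 < nu ->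
  `|z| * avg_kernel nu z <= nu.
Proof.
move=> nu0; have := add1_expRN_le1 (`|z| / nu); rewrite -/(avg_kernel nu z) => H.
have e0 := avg_kernel_gt0 nu z.
have -> : `|z| * avg_kernel nu z = nu * ((`|z| / nu) * avg_kernel nu z).
  by field; rewrite gt_eqF.
by rewrite ger_pMr//; lra.
Qed.

Lemma norm_moment_kernel (R : realType) (nu z : R) : 0 < nu ->
  `|moment_kernel nu z| <= nu.
Proof.
move=> nu0; rewrite normrM (gtr0_norm (avg_kernel_gt0 _ _)).
exact: norm_mul_avg_kernel.
Qed.

Lemma pair_kernel_gt0 (R : realType) (nu z : R) : 0 < nu -> 0 < pair_kernel nu z.
Proof. by move=> nu0; rewrite mulr_gt0 ?avg_kernel_gt0// ltr_pwDl. Qed.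

Lemma norm_pair_kernel (R : realType) (nu z : R) : 0 < nu ->
  `|pair_kernel nu z| <= nu.
Proof.
move=> nu0; rewrite gtr0_norm ?pair_kernel_gt0//.
have := add1_expRN_le1 (`|z| / nu); rewrite -/(avg_kernel nu z) => H.
have -> : pair_kernel nu z = nu * ((1 + `|z| / nu) * avg_kernel nu z).
  by rewrite /pair_kernel; field; rewrite gt_eqF.
by rewrite ger_pMr.
Qed.

Lemma norm_avg_kernel' (R : realType) (nu z : R) : 0 < nu ->
  `|avg_kernel' nu z| <= nu^-1.
Proof.
move=> nu0; have H : `|avg_kernel nu z / nu| <= nu^-1.
  by rewrite normrM (gtr0_norm (avg_kernel_gt0 _ _)) gtr0_norm ?invr_gt0// ler_piMl
      ?invr_ge0 ?avg_kernel_le1// ltW.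
by rewrite /avg_kernel'; case: ifP => _; rewrite ?normrN.
Qed.

Lemma norm_moment_kernel' (R : realType) (nu z : R) : 0 < nu ->
  `|moment_kernel' nu z| <= 2.
Proof.
move=> nu0; rewrite normrM (gtr0_norm (avg_kernel_gt0 _ _)).
have := add1_expRN_le1 (`|z| / nu); rewrite -/(avg_kernel nu z) => H.
rewrite (@le_trans _ _ ((1 + `|z| / nu) * avg_kernel nu z))//; last by lra.
rewrite ler_wpM2r ?(ltW (avg_kernel_gt0 _ _))//.
by rewrite (le_trans (ler_normB _ _))// normr1 lerD2l ger0_norm// divr_ge0// ltW.
Qed.

Lemma norm_pair_kernel' (R : realType) (nu z : R) : 0 < nu ->
  `|pair_kernel' nu z| <= 1.
Proof.
move=> nu0; rewrite normrN normrM (gtr0_norm (_ : 0 < nu^-1)) ?invr_gt0//.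
by rewrite ler_pdivrMr// mul1r norm_moment_kernel.
Qed.

Lemma avg_kernel_continuous (R : realType) (nu : R) : continuous (avg_kernel nu).
Proof.
move=> z; apply: (@continuous_comp _ _ _ (fun z => - (`|z| / nu)) expR); last exact:
    continuous_expR.
by apply: cvgN; apply: cvgMl; exact: norm_continuous.
Qed.

Lemma moment_kernel_continuous (R : realType) (nu : R) : continuous (moment_kernel nu).
Proof.
by move=> z; apply: cvgM; [exact: cvg_id|exact: avg_kernel_continuous].
Qed.

Lemma moment_kernel'_continuous (R : realType) (nu : R) : continuous (moment_kernel' nu).
Proof.
move=> z; apply: cvgM; last exact: avg_kernel_continuous.
by apply: cvgB; [exact: cvg_cst|apply: cvgMl; exact: norm_continuous].
Qed.

Lemma pair_kernel_continuous (R : realType) (nu : R) : continuous (pair_kernel nu).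
Proof.
move=> z; apply: cvgM; last exact: avg_kernel_continuous.
by apply: cvgD; [exact: cvg_cst|exact: norm_continuous].
Qed.

Lemma pair_kernel'_continuous (R : realType) (nu : R) : continuous (pair_kernel' nu).
Proof.
by move=> z; apply: cvgN; apply: cvgMl; exact: moment_kernel_continuous.
Qed.

Lemma measurable_avg_kernel' (R : realType) (nu : R) :
  measurable_fun setT (avg_kernel' nu).
Proof.
have mk : measurable_fun setT (fun z => avg_kernel nu z / nu).
  apply: continuous_measurable_fun => z; apply: cvgMl; exact: avg_kernel_continuous.
apply: measurable_fun_ifT => //; first exact: measurable_fun_ltr.
exact: measurableT_comp.
Qed.

Lemma is_derive_normr (R : realType) (z : R) : z != 0 ->
  is_derive z (1 : R) (fun y => `|y|) (if 0 < z then 1 else -1).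
Proof.
move=> z0; have [zp|zn] := ltP 0 z.
  apply: (@near_eq_is_derive _ _ _ id).
  near=> y; rewrite gtr0_norm//; near: y; exact: lt_nbhsr.
have {}zn : z < 0 by rewrite lt_neqAle z0.
apply: (@near_eq_is_derive _ _ _ -%R).
near=> y; rewrite ltr0_norm//; near: y; exact: lt_nbhsl.
Unshelve. all: by end_near. Qed.

Lemma avg_kernel_is_derive (R : realType) (nu z : R) : z != 0 ->
  is_derive z (1 : R) (avg_kernel nu) (avg_kernel' nu z).
Proof.
move=> z0; have dn := is_derive_normr z0.
have H1 : is_derive z (1:R) (fun y => - nu^-1 * `|y|) (- nu^-1 * (if 0 < z then 1 else -1)).
  have := is_derive_mul (is_derive_cst (- nu^-1 : R) z (1:R)) dn.
  by rewrite mul0r add0r.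
have := is_derive_expR_comp H1.
have -> : (fun y => expR (- nu^-1 * `|y|)) = avg_kernel nu.
  by apply/funext => y /=; rewrite /avg_kernel mulNr mulrC.
have E : - nu^-1 * `|z| = - (`|z| / nu) by ring.
congr is_derive; rewrite /avg_kernel' /avg_kernel E.
by case: ifP => _; ring.
Qed.

Lemma moment_kernel_is_derive (R : realType) (nu z : R) : z != 0 ->
  is_derive z (1 : R) (moment_kernel nu) (moment_kernel' nu z).
Proof.
move=> z0; have := is_derive_mul (is_derive_id z (1:R)) (avg_kernel_is_derive nu z0).
congr is_derive; rewrite /moment_kernel' /avg_kernel'.
have [zp|zn] := ltP 0 z; first by rewrite gtr0_norm//; ring.
by rewrite ler0_norm//; ring.
Qed.

Lemma pair_kernel_is_derive (R : realType) (nu z : R) : nu != 0 -> z != 0 ->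
  is_derive z (1 : R) (pair_kernel nu) (pair_kernel' nu z).
Proof.
move=> nu0 z0; have := is_derive_mul (is_derive_add (is_derive_cst nu z (1:R))
    (is_derive_normr z0)) (avg_kernel_is_derive nu z0).
congr is_derive; rewrite /pair_kernel' /moment_kernel /avg_kernel' /=.
have [zp|zn] := ltP 0 z; first by rewrite gtr0_norm//; field.
by rewrite ler0_norm//; field.
Qed.

(** Used with [y] integrated out: the local average at [x] is at least
    [exp (- |x| / nu)] times the one at 0, however small the density is near [x]. *)
Lemma avg_kernel_sub_ge (R : realType) (nu x y : R) : 0 < nu ->
  avg_kernel nu x * avg_kernel nu y <= avg_kernel nu (x - y).
Proof.
move=> nu0; rewrite /avg_kernel -expRD ler_expR -opprD lerN2 -mulrDl.
by rewrite ler_wpM2r ?invr_ge0 ?(ltW nu0)// ler_normB.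
Qed.

(** Where [|z| <= 2 |x|] the first term dominates. Elsewhere [|z| - |x|] is at least
    half of [|z|], and the exponential of the excess absorbs the factor [|z|]. *)
Lemma moment_kernel_split (R : realType) (nu x z : R) : 0 < nu ->
  `|moment_kernel nu z| <= 2 * `|x| * avg_kernel nu z + 2 * nu * avg_kernel nu x.
Proof.
move=> nu0; rewrite normrM (gtr0_norm (avg_kernel_gt0 _ _)).
have ez := avg_kernel_gt0 nu z; have ex := avg_kernel_gt0 nu x.
have [zx|xz] := leP `|z| (2 * `|x|).
  by rewrite -[leLHS]addr0 lerD ?ler_wpM2r ?(ltW ez)// !mulr_ge0// ltW.
rewrite -[leLHS]add0r lerD//; first by rewrite !mulr_ge0// ltW.
have -> : avg_kernel nu z = expR (- ((`|z| - `|x|) / nu)) * avg_kernel nu x.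
  by rewrite /avg_kernel -expRD; congr expR; ring.
rewrite mulrA ler_wpM2r ?(ltW ex)//.
set u := (`|z| - `|x|) / nu.
(* [|z| > 2 |x|] makes [|z|] at most twice [nu * u], and [u * exp (- u) <= 1]. *)
have zu : `|z| <= 2 * nu * u.
  have -> : 2 * nu * u = 2 * (`|z| - `|x|) by rewrite /u; field; rewrite gt_eqF.
  by lra.
apply: (@le_trans _ _ (2 * nu * u * expR (- u))); first by rewrite ler_wpM2r// expR_ge0.
have e0 := expR_ge0 (- u).
by rewrite -mulrA ger_pMr ?mulr_gt0//; have := add1_expRN_le1 u; lra.
Qed.

(** * The averaging kernel convolved with itself *)

Lemma integral_expR_tail (R : realType) (nu a b : R) : 0 < nu ->
  (\int[@lebesgue_measure R]_(x in `[a, +oo[) (expR (- ((2 * x + b) / nu)))%:E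
   = (nu / 2 * expR (- ((2 * a + b) / nu)))%:E)%E.
Proof.
move=> nu0.
pose F x : R := - (nu / 2) * expR (- ((2 * x + b) / nu)).
have dF x : is_derive x (1 : R) F (expR (- ((2 * x + b) / nu))).
  have Hi : is_derive x (1 : R) (fun y => - (2 / nu) * y + - (b / nu)) (- (2 / nu)).
    have := is_derive_add (is_derive_mul (is_derive_cst (- (2 / nu) : R) x (1:R))
        (is_derive_id x (1:R)))
      (is_derive_cst (- (b / nu) : R) x (1:R)).
    by rewrite /= mul0r add0r mulr1 addr0.
  have := is_derive_mul (is_derive_cst (- (nu / 2) : R) x (1:R)) (is_derive_expR_comp Hi).
  have E y : - (2 / nu) * y + - (b / nu) = - ((2 * y + b) / nu).
    by field; rewrite gt_eqF.
  have -> : (fun y => cst (- (nu / 2)) y * expR (- (2 / nu) * y + - (b / nu))) = F.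
    by apply/funext => y; rewrite E.
  by congr is_derive; rewrite /= E; field; rewrite gt_eqF.
have cE : continuous (fun x : R => expR (- ((2 * x + b) / nu))).
  move=> x; apply: (@continuous_comp _ _ _ (fun x : R => - ((2 * x + b) / nu)) expR);
      last exact: continuous_expR.
  apply: cvgN; apply: cvgMl; apply: cvgD; last exact: cvg_cst.
  by apply: cvgMr; exact: cvg_id.
rewrite (@ge0_continuous_FTC2y _ _ F a 0).
- by rewrite sub0e -EFinN /F mulNr opprK.
- by move=> x _; exact: expR_ge0.
- exact: continuous_subspaceT.
- rewrite -[X in _ --> X](mulr0 (- (nu / 2))); apply: cvgMr.
  apply: (@cvg_comp _ _ _ (fun x => (2 * x + b) / nu) (fun x => expR (- x)) _ (pinfty_nbhs R)).
    apply/cvgryPge => A; near=> x.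
    rewrite ler_pdivlMr//.
    have : (A * nu - b) / 2 <= x by near: x; apply: nbhs_pinfty_ge; rewrite num_real.
    by rewrite ler_pdivrMr//; lra.
  exact: cvgr_expR.
- by move=> x _; have [] := dF x.
- apply: cvg_at_right_filter; exact: (is_derive_continuous (dF a)).
- by move=> x _; rewrite derive1E; have [] := dF x.
Unshelve. all: by end_near. Qed.

(** For [0 <= d] the integrand is constant between 0 and [d], which contributes
    [d exp (- d / nu)], and each of the two exponential tails contributes
    [nu / 2 exp (- d / nu)]. *)
Lemma avg_kernel_self_conv_ge0 (R : realType) (nu d : R) : 0 < nu -> 0 <= d ->
  (\int[@lebesgue_measure R]_x (avg_kernel nu x * avg_kernel nu (d - x))%:E
   = (pair_kernel nu d)%:E)%E.
Proof.
move=> nu0 d0.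
pose I x : R := avg_kernel nu x * avg_kernel nu (d - x).
have cI : continuous I.
  move=> x; apply: cvgM; first exact: avg_kernel_continuous.
  apply: (@continuous_comp _ _ _ (fun x => d - x) (avg_kernel nu)); last exact:
      avg_kernel_continuous.
  by apply: cvgB; [exact: cvg_cst|exact: cvg_id].
have mI : measurable_fun setT (EFin \o I).
  by apply/measurable_EFinP; exact: continuous_measurable_fun.
have I0 x : 0 <= I x by rewrite mulr_ge0// ltW// avg_kernel_gt0.
suff : (\int[@lebesgue_measure R]_x (I x)%:E = (pair_kernel nu d)%:E)%E by [].
have -> : [set: R] = `]-oo, 0] `|` (`]0, d] `|` `]d, +oo[).
  apply/seteqP; split => // x _ /=; rewrite !in_itv/= andbT.
  have [x0|x0] := leP x 0; first by left.
  by have [xd|xd] := leP x d; right; [left|right].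
rewrite ge0_integral_setU//=; first last.
- apply/disj_setPS => x [/=]; rewrite !in_itv/= andbT => x0 [/andP[]|]; lra.
- by move=> x _; rewrite lee_fin.
- exact: measurable_funTS.
- exact: measurableU.
rewrite ge0_integral_setU//=; first last.
- apply/disj_setPS => x [/=]; rewrite !in_itv/= andbT => /andP[]; lra.
- by move=> x _; rewrite lee_fin.
- exact: measurable_funTS.
have -> : (\int[@lebesgue_measure R]_(x in `]-oo, 0%R]) (I x)%:E = (nu / 2 * avg_kernel
    nu d)%:E)%E.
  rewrite -{1}(oppr0 R) ge0_integration_by_substitutionNy; last 2 first.
  - exact: continuous_subspaceT.
  - by move=> x _.
  rewrite (_ : avg_kernel nu d = expR (- ((2 * 0 + d) / nu))); last first.
    by rewrite /avg_kernel ger0_norm// mulr0 add0r.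
  rewrite -integral_expR_tail//; apply: eq_integral => x.
  rewrite inE/= in_itv/= andbT => x0; congr EFin.
  rewrite /= /I /avg_kernel -expRD opprK normrN !ger0_norm ?addr_ge0//.
  by congr expR; ring.
have -> : (\int[@lebesgue_measure R]_(x in `]0%R, d]) (I x)%:E = (d * avg_kernel nu d)%:E)%E.
  under eq_integral => x.
    rewrite inE/= in_itv/= => /andP[x0 xd].
    have -> : I x = avg_kernel nu d.
      rewrite /I /avg_kernel -expRD (ger0_norm (ltW x0)) (ger0_norm d0) ger0_norm ?subr_ge0//.
      by congr expR; ring.
    over.
  rewrite integral_cst//= lebesgue_measure_itv/= lte_fin.
  case: ifPn => [_|]; first by rewrite ?oppr0 addr0 -EFinM mulrC.
  rewrite -leNgt => d0'; have -> : d = 0 by lra.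
  by rewrite mule0 mul0r.
have -> : (\int[@lebesgue_measure R]_(x in `]d, +oo[) (I x)%:E = (nu / 2 * avg_kernel nu d)%:E)%E.
  rewrite integral_itv_obnd_cbnd; last exact: measurable_funTS.
  rewrite (_ : avg_kernel nu d = expR (- ((2 * d + - d) / nu))); last first.
    by rewrite /avg_kernel ger0_norm//; congr expR; ring.
  rewrite -integral_expR_tail//; apply: eq_integral => x.
  rewrite inE/= in_itv/= andbT => dx; congr EFin.
  rewrite /I /avg_kernel -expRD (ger0_norm (le_trans d0 dx)) ler0_norm ?subr_le0//.
  by congr expR; ring.
rewrite -!EFinD /pair_kernel (ger0_norm d0); congr EFin.
by field.
Qed.

Lemma avg_kernel_self_conv (R : realType) (nu y z : R) : 0 < nu ->
  (\int[@lebesgue_measure R]_x (avg_kernel nu (x - z) * avg_kernel nu (x - y))%:E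
   = (pair_kernel nu (y - z))%:E)%E.
Proof.
move=> nu0.
wlog yz : y z / z <= y.
  move=> H; have [/H//|/ltW yz] := leP z y.
  rewrite -pair_kernelN opprB -(H _ _ yz).
  by apply: eq_integral => x _; rewrite mulrC.
rewrite -avg_kernel_self_conv_ge0 ?subr_ge0//.
(* Centre at [y]: the reflected variable [y - x] brings the two kernels to the
   positions 0 and [y - z]. *)
rewrite -(@integral_reflection _ y (fun x => (avg_kernel nu x * avg_kernel nu (y - z - x))%:E)).
- apply: eq_integral => x _; rewrite mulrC -(avg_kernelN _ (x - y)) opprB.
  by congr (_ * avg_kernel nu _)%:E; ring.
- apply/measurable_EFinP/measurable_funM.
    by apply: continuous_measurable_fun; exact: avg_kernel_continuous.
  by apply: measurable_translate; apply: continuous_measurable_fun; exact: avg_kernel_continuous.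
- by move=> x; rewrite lee_fin mulr_ge0// ltW// avg_kernel_gt0.
Qed.

(** * Integration by parts with a cutoff *)

Lemma dominated_sequence (R : realType) (u : nat -> R -> R) (f G : R -> R) :
  (forall n, measurable_fun setT (u n)) -> measurable_fun setT f ->
  (@lebesgue_measure R).-integrable setT (EFin \o G) ->
  (forall n x, `|u n x| <= G x) ->
  (forall x, u n x @[n --> \oo] --> f x) ->
  \int[@lebesgue_measure R]_x u n x @[n --> \oo] --> \int[@lebesgue_measure R]_x f x.
Proof.
move=> mu mf iG uG uf.
have [] := @dominated_convergence _ _ _ (@lebesgue_measure R) _ measurableT
  (fun n => EFin \o u n) (EFin \o f) (EFin \o G).
- by move=> n; apply/measurable_EFinP; exact: mu.
- exact/measurable_EFinP.
- apply: aeW => x _ /=; apply/cvg_EFin; first by apply: nearW.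
  exact: uf.
- exact: iG.
- by apply: aeW => x n _ /=; rewrite lee_fin.
move=> iF _ cv; apply: fine_cvg; rewrite fineK//.
exact: integrable_fin_num.
Qed.

Lemma integral_derivative_eq0 (R : realType) (F f : R -> R) :
  (forall x, is_derive x (1 : R) F (f x)) -> continuous f ->
  (@lebesgue_measure R).-integrable setT (EFin \o f) ->
  F x @[x --> -oo] --> (0 : R) -> F x @[x --> +oo] --> (0 : R) ->
  \int[@lebesgue_measure R]_x f x = 0.
Proof.
move=> dF cf intf FN FP.
have mf := continuous_measurable_fun cf.
have cF x : {for x, continuous F} by exact: is_derive_continuous (dF x).
pose I (n : nat) : set R := `[- n.+1%:R, n.+1%:R]%classic.
have FTC n : \int[@lebesgue_measure R]_x (f \_ (I n)) x = F n.+1%:R - F (- n.+1%:R).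
  rewrite -Rintegral_mkcond /Rintegral (@continuous_FTC2 _ f F)//.
  - by rewrite gtrN.
  - exact: continuous_subspaceT.
  - split; first by move=> x _; have [] := dF x.
      exact/cvg_at_right_filter/cF.
    exact/cvg_at_left_filter/cF.
  - by move=> x _; rewrite derive1E; have [] := dF x.
have L1 : \int[@lebesgue_measure R]_x (f \_ (I n)) x @[n --> \oo] -->
    \int[@lebesgue_measure R]_x f x.
  apply: (@dominated_sequence _ _ _ (fun x => `|f x|)) => //.
  - move=> n; by apply: (measurable_restrictT f _).1; [rewrite /I|exact: measurable_funTS].
  - exact: integrable_norm.
  - by move=> n x; rewrite /patch; case: ifP => // _; rewrite normr0.
  - move=> x; apply: cvg_near_cst; near=> n.
    rewrite /patch ifT// inE /I/= in_itv/= -ler_norml.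
    have : `|x| <= n%:R by near: n; exact: nbhs_infty_ger.
    by move=> /le_trans; apply; rewrite ler_nat.
have L2 : F n.+1%:R - F (- n.+1%:R) @[n --> \oo] --> (0 : R) - 0.
  have cN : n.+1%:R @[n --> \oo] --> (+oo : set_system R).
    apply/cvgryPge => A; near=> n.
    have : A <= n%:R by near: n; exact: nbhs_infty_ger.
    by move=> /le_trans; apply; rewrite ler_nat.
  apply: cvgB; first exact: cvg_comp cN FP.
  apply: (@cvg_comp _ _ _ (fun n : nat => - n.+1%:R) F _ (ninfty_nbhs R)) => //.
  exact/cvgNrNy.
move: L1; under eq_fun do rewrite FTC.
by move=> L1; rewrite (cvg_unique _ L1 L2)// subrr.
Unshelve. all: by end_near. Qed.

(** The two estimates on [chi x = 1 / (1 + x ^ 2 / N)] needed below: [chi] tames linear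
    growth for each [N], and its derivative does so uniformly in [N]. *)
Lemma cutoff_bound (R : realType) (N x : R) : 1 <= N ->
  (1 + x ^+ 2 / N)^-1 * (1 + `|x|) <= 2 * N /\
  (1 + x ^+ 2 / N)^-1 ^+ 2 * (2 * `|x| / N) * (1 + `|x|) <= 4.
Proof.
move=> N1; have N0 : 0 < N by lra.
have d0 : 0 < 1 + x ^+ 2 / N by rewrite ltr_pwDl// divr_ge0// ?sqr_ge0// ltW.
rewrite -real_normK ?num_real// in d0 *.
set y := `|x| in d0 *; have y0 : 0 <= y by exact: normr_ge0.
have NE : 1 + y ^+ 2 / N = (N + y ^+ 2) / N by field; rewrite gt_eqF.
have P0 : 0 < N + y ^+ 2 by nra.
rewrite NE; split.
  rewrite invf_div mulrAC ler_pdivrMr//.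
  have H : 0 <= 2 * N + 2 * y ^+ 2 - (1 + y) by have := sqr_ge0 (y - 1); nra.
  by have := mulr_ge0 (ltW N0) H; lra.
rewrite invf_div.
have -> : (N / (N + y ^+ 2)) ^+ 2 * (2 * y / N) * (1 + y) = (2 * N * y * (1 + y)) / (N +
    y ^+ 2) ^+ 2.
  by field; rewrite ?gt_eqF//; apply/andP; split; rewrite gt_eqF.
rewrite ler_pdivrMr ?exprn_gt0//.
have H1 : 0 <= N * (1 - y) ^+ 2 by rewrite mulr_ge0 ?sqr_ge0// ltW.
have H2 : 0 <= N * y ^+ 2 by rewrite mulr_ge0 ?sqr_ge0// ltW.
have H3 : 0 <= N * (N - 1) by rewrite mulr_ge0 ?subr_ge0// ltW.
have H4 : 0 <= y ^+ 4 by rewrite exprn_ge0.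
have H5 := sqr_ge0 N.
nra.
Qed.

(** Formally [V] vanishes at infinity and its derivative integrates to 0, but the
    linear factor in the bound on [V] means that this does not follow from the
    decay of [p]. Multiply [V] by [chi n x = 1 / (1 + x ^ 2 / (n + 1))]: then
    [chi n * V] does vanish at infinity, the error term [chi n' * V] is dominated by
    a multiple of [p] and tends to 0 pointwise, and [chi n * q] increases to [q]. *)
Lemma integral_by_cutoff (R : realType) (V a q p : R -> R) (C : R) :
  (forall x, is_derive x (1 : R) V (a x - q x)) ->
  continuous a -> continuous q ->
  (@lebesgue_measure R).-integrable setT (EFin \o a) ->
  (@lebesgue_measure R).-integrable setT (EFin \o p) ->
  (forall x, 0 <= q x) -> (forall x, 0 <= p x) -> 0 <= C ->
  (forall x, `|V x| <= C * (1 + `|x|) * p x) ->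
  (forall x, q x <= C * (1 + `|x|) * p x) ->
  p x @[x --> -oo] --> (0 : R) -> p x @[x --> +oo] --> (0 : R) ->
  (\int[@lebesgue_measure R]_x (q x)%:E = (\int[@lebesgue_measure R]_x a x)%:E)%E.
Proof.
move=> dV ca cq ia ip q0 p0 C0 bV bq pN pP.
pose N (n : nat) : R := n.+1%:R.
have N1 n : 1 <= N n by rewrite ler1n.
have N0 n : 0 < N n by rewrite ltr0n.
pose chi n (x : R) : R := (1 + x ^+ 2 / N n)^-1.
pose chi' n (x : R) : R := - (2 * x / N n) * chi n x ^+ 2.
have den_gt0 n x : 0 < 1 + x ^+ 2 / N n.
  by rewrite ltr_pwDl// divr_ge0// ?sqr_ge0// ltW.
have chi_gt0 n x : 0 < chi n x by rewrite invr_gt0.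
have chi_le1 n x : chi n x <= 1.
  by rewrite invf_le1// lerDl divr_ge0// ?sqr_ge0// ltW.
have dchi n x : is_derive x (1 : R) (chi n) (chi' n x).
  have H : is_derive x (1 : R) (fun y : R => 1 + y ^+ 2 / N n) (2 * x / N n).
    have Hid := is_derive_id x (1 : R).
    have := is_derive_add (is_derive_cst (1 : R) x (1 : R))
      (is_derive_mul (is_derive_mul Hid Hid) (is_derive_cst ((N n)^-1) x (1 : R))).
    by congr is_derive; rewrite /=; ring.
  have den0 : 1 + x ^+ 2 / N n != 0 by rewrite gt_eqF.
  have := @is_derive_inv R (fun y : R => 1 + y ^+ 2 / N n) x _ den0 H.
  by congr is_derive; rewrite /chi' /chi exprVn; ring.
have cchi n : continuous (chi n) by move=> x; exact: is_derive_continuous (dchi n x).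
have cchi' n : continuous (chi' n).
  move=> x; apply: cvgM; last by apply: cvgM; exact: cchi.
  by apply: cvgN; apply: cvgMl; apply: cvgMr; exact: cvg_id.
have cV : continuous V by move=> x; exact: is_derive_continuous (dV x).
have bchiV n x : `|chi n x * V x| <= 2 * N n * C * p x.
  rewrite normrM (gtr0_norm (chi_gt0 n x)).
  apply: le_trans (ler_wpM2l (ltW (chi_gt0 n x)) (bV x)) _.
  have [+ _] := cutoff_bound x (N1 n); rewrite -/(chi n x) => H.
  have -> : chi n x * (C * (1 + `|x|) * p x) = chi n x * (1 + `|x|) * (C * p x) by ring.
  by rewrite -(mulrA _ C) ler_wpM2r// mulr_ge0.
have bchiq n x : `|chi n x * q x| <= 2 * N n * C * p x.
  rewrite normrM (gtr0_norm (chi_gt0 n x)) (ger0_norm (q0 x)).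
  apply: le_trans (ler_wpM2l (ltW (chi_gt0 n x)) (bq x)) _.
  have [+ _] := cutoff_bound x (N1 n); rewrite -/(chi n x) => H.
  have -> : chi n x * (C * (1 + `|x|) * p x) = chi n x * (1 + `|x|) * (C * p x) by ring.
  by rewrite -(mulrA _ C) ler_wpM2r// mulr_ge0.
have bchi'V n x : `|chi' n x * V x| <= 4 * C * p x.
  rewrite normrM.
  apply: le_trans (ler_wpM2l (normr_ge0 _) (bV x)) _.
  have -> : `|chi' n x| = chi n x ^+ 2 * (2 * `|x| / N n).
    rewrite /chi' mulNr normrN normrM (gtr0_norm (exprn_gt0 2 (chi_gt0 n x))).
    rewrite 2!normrM (gtr0_norm (_ : 0 < 2 :> R))// (gtr0_norm (_ : 0 < (N n)^-1)) ?invr_gt0//.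
    by rewrite mulrC.
  have [_ +] := cutoff_bound x (N1 n); rewrite -/(chi n x) => H.
  have -> : chi n x ^+ 2 * (2 * `|x| / N n) * (C * (1 + `|x|) * p x) =
    chi n x ^+ 2 * (2 * `|x| / N n) * (1 + `|x|) * (C * p x) by ring.
  by rewrite -(mulrA _ C) ler_wpM2r// mulr_ge0.
have mchia n : measurable_fun setT (fun x => chi n x * a x).
  by apply: continuous_measurable_fun => x; apply: cvgM; [exact: cchi|exact: ca].
have mchiq n : measurable_fun setT (fun x => chi n x * q x).
  by apply: continuous_measurable_fun => x; apply: cvgM; [exact: cchi|exact: cq].
have mchi'V n : measurable_fun setT (fun x => chi' n x * V x).
  by apply: continuous_measurable_fun => x; apply: cvgM; [exact: cchi'|exact: cV].
have ipZ c : (@lebesgue_measure R).-integrable setT (EFin \o (fun x => c * p x)).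
  exact: integrable_scale ip.
have ichia n : (@lebesgue_measure R).-integrable setT (EFin \o (fun x => chi n x * a x)).
  apply: (@integrable_bounded_mul _ _ _ 1) => //.
    exact: continuous_measurable_fun.
  by move=> x; rewrite gtr0_norm.
have ichiq n : (@lebesgue_measure R).-integrable setT (EFin \o (fun x => chi n x * q x)).
  exact: integrable_bound (ipZ _) (bchiq n).
have ichi'V n : (@lebesgue_measure R).-integrable setT (EFin \o (fun x => chi' n x * V x)).
  exact: integrable_bound (ipZ _) (bchi'V n).
have ipart n : (@lebesgue_measure R).-integrable setT (EFin \o (fun x => chi n x * a x +
    chi' n x * V x)).
  exact: integrable_add (ichia n) (ichi'V n).
(* The derivative of [chi n * V] integrates to 0. *)
have cut n : \int[@lebesgue_measure R]_x (chi n x * q x) =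
    \int[@lebesgue_measure R]_x (chi n x * a x + chi' n x * V x).
  apply/esym/eqP; rewrite -subr_eq0 -RintegralB//.
  apply/eqP; apply: (@integral_derivative_eq0 _ (fun x => chi n x * V x)).
  - move=> x; have := is_derive_mul (dchi n x) (dV x).
    by congr is_derive; ring.
  - move=> x; apply: cvgB; last by apply: cvgM; [exact: cchi|exact: cq].
    by apply: cvgD; apply: cvgM; [exact: cchi|exact: ca|exact: cchi'|exact: cV].
  - exact: integrable_sub (ipart n) (ichiq n).
  - apply/norm_cvg0P; apply: (@squeeze_cvgr _ _ _ _ (cst 0) (fun x => 2 * N n * C * p x)).
    + by apply: nearW => x; rewrite normr_ge0/= bchiV.
    + exact: cvg_cst.
    + by rewrite -[X in _ --> X](mulr0 (2 * N n * C)); exact: cvgMr.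
  - apply/norm_cvg0P; apply: (@squeeze_cvgr _ _ _ _ (cst 0) (fun x => 2 * N n * C * p x)).
    + by apply: nearW => x; rewrite normr_ge0/= bchiV.
    + exact: cvg_cst.
    + by rewrite -[X in _ --> X](mulr0 (2 * N n * C)); exact: cvgMr.
have chi_cvg x : chi n x @[n --> \oo] --> (1 : R).
  have : (1 + x ^+ 2 * (n.+1%:R)^-1)^-1 @[n --> \oo] --> (1 + x ^+ 2 * 0 : R)^-1.
    apply: cvgV; first by rewrite mulr0 addr0 oner_neq0.
    by apply: cvgD; [exact: cvg_cst|apply: cvgMr; exact: cvg_harmonic].
  by rewrite mulr0 addr0 invr1.
have chi'_cvg x : chi' n x @[n --> \oo] --> (0 : R).
  have : - (2 * x * (n.+1%:R)^-1) * chi n x ^+ 2 @[n --> \oo] --> - (2 * x * 0) * (1 : R) ^+ 2.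
    apply: cvgM; last by apply: cvgM; exact: chi_cvg.
    by apply: cvgN; apply: cvgMr; exact: cvg_harmonic.
  by rewrite mulr0 oppr0 mul0r.
have RHS : \int[@lebesgue_measure R]_x (chi n x * a x + chi' n x * V x) @[n --> \oo] -->
    \int[@lebesgue_measure R]_x a x.
  apply: (@dominated_sequence _ _ _ (fun x => `|a x| + 4 * C * p x)).
  - by move=> n; apply: measurable_funD.
  - exact: continuous_measurable_fun.
  - exact: integrable_add (integrable_norm ia) (ipZ (4 * C)).
  - move=> n x; rewrite (le_trans (ler_normD _ _))// lerD//.
    by rewrite normrM (gtr0_norm (chi_gt0 n x)) ler_piMl.
  - move=> x; rewrite -[X in _ --> X]addr0 -[X in _ --> X + _]mul1r -[X in _ --> _ +
      X](mul0r (V x)).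
    by apply: cvgD; apply: cvgMl.
have LHS : (\int[@lebesgue_measure R]_x (chi n x * q x)%:E @[n --> \oo] -->
    \int[@lebesgue_measure R]_x (q x)%:E)%E.
  have -> : (\int[@lebesgue_measure R]_x (q x)%:E =
      \int[@lebesgue_measure R]_x limn (fun n => (chi n x * q x)%:E))%E.
    apply: eq_integral => x _; apply/esym/cvg_lim => //.
    apply: cvg_EFin; first by apply: nearW.
    by rewrite -[X in _ --> X]mul1r; apply: cvgMl; exact: chi_cvg.
  apply: (@cvg_monotone_convergence _ _ _ (@lebesgue_measure R) setT measurableT
    (fun n x => (chi n x * q x)%:E)).
  - by move=> n; apply/measurable_EFinP; exact: mchiq.
  - by move=> n x _; rewrite lee_fin mulr_ge0// ltW.
  - move=> x _ n m nm; rewrite lee_fin ler_wpM2r// lef_pV2 ?posrE//.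
    by rewrite lerD2l ler_wpM2l ?sqr_ge0// lef_pV2 ?posrE// ler_nat.
apply: (cvg_unique _ LHS) => //.
have E n : (\int[@lebesgue_measure R]_x (chi n x * q x)%:E = (\int[@lebesgue_measure R]_x
    (chi n x * a x + chi' n x * V x))%:E)%E.
  by rewrite -cut /Rintegral fineK//; exact: integrable_fin_num (ichiq n).
rewrite /=; under eq_fun do rewrite E.
by apply: cvg_EFin; [apply: nearW|exact: RHS].
Qed.

(** * Local averages of a probability density *)

Definition is_density (R : realType) (p : R -> R) : Prop :=
  [/\ continuous p, forall x, 0 <= p x &
      (\int[@lebesgue_measure R]_x (p x)%:E = 1)%E].

Lemma density_measurable (R : realType) (p : R -> R) :
  is_density p -> measurable_fun setT p.
Proof. by move=> [cp _ _]; exact: continuous_measurable_fun. Qed.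

Lemma density_integrable (R : realType) (p : R -> R) :
  is_density p -> (@lebesgue_measure R).-integrable setT (EFin \o p).
Proof.
move=> dp; have [_ p0 p1] := dp; apply/integrableP; split.
  by apply/measurable_EFinP; exact: density_measurable.
under eq_integral do rewrite /= ger0_norm//.
by rewrite p1 ltry.
Qed.

Lemma integral_abs_eq0_transfer (R : realType) (u v : R -> R) (c : R) :
  measurable_fun setT u -> measurable_fun setT v ->
  (forall x, x != c -> u x = 0 -> v x = 0) ->
  (\int[@lebesgue_measure R]_x `|u x|%:E = 0)%E ->
  (\int[@lebesgue_measure R]_x `|v x|%:E = 0)%E.
Proof.
move=> mu mv uv.
have mEu : measurable_fun setT (EFin \o u) by apply/measurable_EFinP.
have mEv : measurable_fun setT (EFin \o v) by apply/measurable_EFinP.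
move=> /(ae_eq_integral_abs (@lebesgue_measure R) measurableT mEu) [N [mN N0 sN]].
apply: (ae_eq_integral_abs (@lebesgue_measure R) measurableT mEv).2.
exists (N `|` [set c]); split.
- exact: measurableU.
- by rewrite null_set_setU//; exact: lebesgue_measure_set1.
- move=> x /= nx; have [->|xc] := eqVneq x c; [by right|left].
  apply: sN => /= H; apply: nx => _.
  have /eqP := H I; rewrite eqe => /eqP ux0.
  by rewrite uv.
Qed.

(** The weight is allowed to vanish at one point because the weights used below
    vanish on a diagonal. *)
Lemma weighted_integral_gt0 (R : realType) (w p : R -> R) (c : R) :
  is_density p -> measurable_fun setT w -> (forall x, 0 <= w x) ->
  (forall x, x != c -> 0 < w x) ->
  (0 < \int[@lebesgue_measure R]_x (w x * p x)%:E)%E.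
Proof.
move=> dp mw w0 wc; have [_ p0 p1] := dp; have mp := density_measurable dp.
rewrite lt_neqAle integral_ge0 ?andbT; last by move=> x _; rewrite lee_fin mulr_ge0.
apply/eqP => wp0.
have : (\int[@lebesgue_measure R]_x `|p x|%:E = 0)%E.
  apply: (@integral_abs_eq0_transfer _ (fun x => w x * p x) p c) => //.
  - exact: measurable_funM.
  - by move=> x xc /eqP; rewrite mulf_eq0 (gt_eqF (wc x xc))/= => /eqP.
  - by rewrite [RHS]wp0; apply: eq_integral => x _; rewrite ger0_norm// mulr_ge0.
under eq_integral do rewrite /= ger0_norm//.
by rewrite p1 => /eqP; rewrite onee_eq0.
Qed.

Lemma EFin_conv (R : realType) (k p : R -> R) (C x : R) :
  is_density p -> measurable_fun setT k -> (forall z, `|k z| <= C) ->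
  ((conv k p x)%:E = \int[@lebesgue_measure R]_y (k (x - y) * p y)%:E)%E.
Proof.
move=> dp mk kC; rewrite /conv /Rintegral fineK//.
exact: integrable_fin_num (integrable_conv x mk kC (density_integrable dp)).
Qed.

Lemma norm_conv_le (R : realType) (k p : R -> R) (C x : R) :
  is_density p -> measurable_fun setT k -> (forall z, `|k z| <= C) ->
  `|conv k p x| <= C.
Proof.
move=> dp mk kC; have [_ p0 p1] := dp; have ip := density_integrable dp.
have ik := integrable_conv x mk kC ip.
rewrite (le_trans (le_normr_Rintegral measurableT ik))//.
have -> : C = \int[@lebesgue_measure R]_y (C * p y).
  by rewrite RintegralZl// /Rintegral p1 mulr1.
apply: le_Rintegral => //.
- exact: integrable_norm ik.
- exact: integrable_scale ip.
- by move=> y _; rewrite normrM (ger0_norm (p0 y)) ler_wpM2r.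
Qed.

Lemma local_density_gt0 (R : realType) (nu : R) (p : R -> R) (x : R) :
  0 < nu -> is_density p -> 0 < conv (avg_kernel nu) p x.
Proof.
move=> nu0 dp; have mk := continuous_measurable_fun (@avg_kernel_continuous R nu).
rewrite -lte_fin (EFin_conv x dp mk (fun z => norm_avg_kernel z nu0)).
apply: (@weighted_integral_gt0 _ (fun y => avg_kernel nu (x - y)) p 0) => //.
- exact: measurable_translate.
- by move=> y; rewrite ltW// avg_kernel_gt0.
- by move=> y _; exact: avg_kernel_gt0.
Qed.

Lemma local_density_ge (R : realType) (nu : R) (p : R -> R) (x : R) :
  0 < nu -> is_density p ->
  avg_kernel nu x * conv (avg_kernel nu) p 0 <= conv (avg_kernel nu) p x.
Proof.
move=> nu0 dp; have mk := continuous_measurable_fun (@avg_kernel_continuous R nu).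
have ip := density_integrable dp; have [_ p0 _] := dp.
have ik y := integrable_conv y mk (fun z => norm_avg_kernel z nu0) ip.
rewrite {1}/conv -RintegralZl//.
apply: le_Rintegral => //.
- exact: integrable_scale (ik 0).
- move=> y _; rewrite mulrA ler_wpM2r//.
  by rewrite sub0r avg_kernelN avg_kernel_sub_ge.
Qed.

Lemma moment_bound_arith (R : realType) (nu a e g0 g : R) :
  0 < nu -> 0 <= a -> 0 < g0 -> 0 <= g -> e * g0 <= g ->
  2 * a * g + 2 * nu * e <= (2 + 2 * nu / g0) * (1 + a) * g.
Proof.
move=> nu0 a0 g00 gx0 eg.
have H1 : 2 * nu * e <= 2 * nu / g0 * g.
  by rewrite -[leRHS]mulrA ler_pM2l ?mulr_gt0// mulrC ler_pdivlMr.
have H2 : 0 <= a * g by rewrite mulr_ge0.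
have H3 : 0 <= 2 * nu / g0 * (a * g).
  by rewrite mulr_ge0// divr_ge0 ?mulr_ge0// ltW.
move: H1 H3; set c := 2 * nu / g0 => H1 H3.
have -> : (2 + c) * (1 + a) * g = 2 * g + 2 * (a * g) + c * g + c * (a * g) by ring.
by lra.
Qed.

(** The mean displacement [h / g] may be unbounded, since [g] can be tiny far from the
    mass of [p], but it grows at most linearly: integrating [moment_kernel_split]
    against [p] gives [|h x| <= 2 |x| g x + 2 nu exp (- |x| / nu)], and
    [local_density_ge] bounds the last exponential by a multiple of [g x]. *)
Lemma norm_local_moment_le (R : realType) (nu : R) (p : R -> R) (x : R) :
  0 < nu -> is_density p ->
  `|conv (moment_kernel nu) p x| <=
    (2 + 2 * nu / conv (avg_kernel nu) p 0) * (1 + `|x|) * conv (avg_kernel nu) p x.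
Proof.
move=> nu0 dp; have mk := continuous_measurable_fun (@avg_kernel_continuous R nu).
have mm := continuous_measurable_fun (@moment_kernel_continuous R nu).
have ip := density_integrable dp; have [_ p0 p1] := dp.
have ik := integrable_conv x mk (fun z => norm_avg_kernel z nu0) ip.
have im := integrable_conv x mm (fun z => norm_moment_kernel z nu0) ip.
have g0 := local_density_gt0 0 nu0 dp; have gx := local_density_gt0 x nu0 dp.
have ge := local_density_ge x nu0 dp.
apply: (@le_trans _ _ (2 * `|x| * conv (avg_kernel nu) p x + 2 * nu * avg_kernel nu x));
    last first.
  exact: (moment_bound_arith nu0 (normr_ge0 x) g0 (ltW gx) ge).
rewrite (le_trans (le_normr_Rintegral measurableT im))//.
have iZ c : (@lebesgue_measure R).-integrable setT (EFin \o (fun y => c * p y)).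
  exact: integrable_scale ip.
have ikZ c : (@lebesgue_measure R).-integrable setT (EFin \o (fun y => c * (avg_kernel nu
    (x - y) * p y))).
  exact: integrable_scale ik.
have P1 : \int[@lebesgue_measure R]_y p y = 1 by rewrite /Rintegral p1.
have -> : 2 * `|x| * conv (avg_kernel nu) p x + 2 * nu * avg_kernel nu x =
   \int[@lebesgue_measure R]_y (2 * `|x| * (avg_kernel nu (x - y) * p y) + 2 * nu *
       avg_kernel nu x * p y).
  by rewrite RintegralD// !RintegralZl// P1 mulr1.
apply: le_Rintegral => //.
- exact: integrable_norm im.
- exact: integrable_add (ikZ (2 * `|x|)) (iZ (2 * nu * avg_kernel nu x)).
- move=> y _; rewrite normrM (ger0_norm (p0 y)) mulrA -mulrDl ler_wpM2r//.
  exact: moment_kernel_split.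
Qed.

(** Expanding the square gives a triple integral of positive functions; integrating
    first in the position [x] of the square convolves the averaging kernel with
    itself. *)
Lemma integral_sqr_local_density (R : realType) (nu : R) (p : R -> R) :
  0 < nu -> is_density p ->
  (\int[@lebesgue_measure R]_x (conv (avg_kernel nu) p x ^+ 2)%:E =
   \int[@lebesgue_measure R]_y (conv (pair_kernel nu) p y * p y)%:E)%E.
Proof.
move=> nu0 dp; have ck := @avg_kernel_continuous R nu.
have mk := continuous_measurable_fun ck.
have mK := continuous_measurable_fun (@pair_kernel_continuous R nu).
have kC z := @norm_avg_kernel R nu z nu0; have KC z := @norm_pair_kernel R nu z nu0.
have ip := density_integrable dp; have [_ p0 p1] := dp; have mp := density_measurable dp.
set g := conv (avg_kernel nu) p.
have g0 x : 0 < g x by exact: local_density_gt0.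
have mg : measurable_fun setT g.
  by apply: continuous_measurable_fun; apply: conv_continuous kC _ ip => // z _; exact: ck.
have gE x : ((g x)%:E = \int[@lebesgue_measure R]_y (avg_kernel nu (x - y) * p y)%:E)%E.
  exact: EFin_conv dp mk kC.
clearbody g.
have k0 z : 0 <= avg_kernel nu z by rewrite ltW// avg_kernel_gt0.
have mfst (u : R -> R) : measurable_fun setT u -> measurable_fun setT (fun z : R * R => u z.1).
  by move=> mu; exact: measurableT_comp mu measurable_fst.
have msnd (u : R -> R) : measurable_fun setT u -> measurable_fun setT (fun z : R * R => u z.2).
  by move=> mu; exact: measurableT_comp mu measurable_snd.
have mdiff (u : R -> R) : measurable_fun setT u -> measurable_fun setT (fun z : R * R =>
    u (z.1 - z.2)).
  move=> mu; apply: measurableT_comp => //.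
  by apply: measurable_funB; [exact: measurable_fst|exact: measurable_snd].
have mky y : measurable_fun setT (fun x : R => avg_kernel nu (x - y)).
  by apply: measurableT_comp => //; exact: measurable_funB.
transitivity (\int[@lebesgue_measure R]_x \int[@lebesgue_measure R]_y (g x * (avg_kernel
    nu (x - y) * p y))%:E)%E.
  apply: eq_integral => x _; rewrite expr2 EFinM [X in (_ * X)%E]gE.
  rewrite -ge0_integralZl//.
  - by apply/measurable_EFinP; apply: measurable_funM => //; exact: measurable_translate.
  - by move=> y _; rewrite lee_fin mulr_ge0.
  - by rewrite lee_fin ltW.
rewrite (@fubini_tonelli _ _ _ _ _ (@lebesgue_measure R) (@lebesgue_measure R) (fun z : R
    * R => (g z.1 * (avg_kernel nu (z.1 - z.2) * p z.2))%:E)); last 2 first.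
- apply/measurable_EFinP; apply: measurable_funM; first exact: mfst.
  by apply: measurable_funM; [exact: mdiff|exact: msnd].
- by move=> z; rewrite lee_fin mulr_ge0 ?(ltW (g0 _))// mulr_ge0.
apply: eq_integral => y _ /=.
transitivity (\int[@lebesgue_measure R]_x ((p y)%:E * (g x * avg_kernel nu (x - y))%:E))%E.
  by apply: eq_integral => x _; rewrite -EFinM; congr EFin; ring.
rewrite ge0_integralZl//; last 3 first.
- by apply/measurable_EFinP; exact: measurable_funM mg (mky y).
- by move=> x _; rewrite lee_fin mulr_ge0// ltW.
- by rewrite lee_fin.
rewrite mulrC EFinM; congr (_ * _)%E.
rewrite (EFin_conv y dp mK KC).
transitivity (\int[@lebesgue_measure R]_x \int[@lebesgue_measure R]_z (avg_kernel nu (x -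
    y) * (avg_kernel nu (x - z) * p z))%:E)%E.
  apply: eq_integral => x _; rewrite mulrC EFinM gE.
  rewrite -ge0_integralZl//.
  - by apply/measurable_EFinP; apply: measurable_funM => //; exact: measurable_translate.
  - by move=> z _; rewrite lee_fin mulr_ge0.
  - by rewrite lee_fin.
apply: (eq_trans (@fubini_tonelli _ _ _ _ _ (@lebesgue_measure R) (@lebesgue_measure R)
  (fun z : R * R => (avg_kernel nu (z.1 - y) * (avg_kernel nu (z.1 - z.2) * p z.2))%:E) _ _)).
- apply/measurable_EFinP; apply: measurable_funM; first exact: (mfst (fun x => avg_kernel
    nu (x - y))).
  by apply: measurable_funM; [exact: mdiff|exact: msnd].
- by move=> z; rewrite lee_fin mulr_ge0// mulr_ge0.
apply: eq_integral => z _ /=.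
transitivity (\int[@lebesgue_measure R]_x ((p z)%:E * (avg_kernel nu (x - z) * avg_kernel
    nu (x - y))%:E))%E.
  by apply: eq_integral => x _; rewrite -EFinM; congr EFin; ring.
rewrite ge0_integralZl//; last 3 first.
- by apply/measurable_EFinP; exact: measurable_funM (mky z) (mky y).
- by move=> x _; rewrite lee_fin mulr_ge0.
- by rewrite lee_fin.
by rewrite avg_kernel_self_conv// -EFinM mulrC.
Qed.

(** * The flux and its dissipation *)

(** The quantity [w] for which the evolution equation reads [f_t = w_x]. *)
Definition flux (R : realType) (nu : R) (p : R -> R) (x : R) : R :=
  conv (moment_kernel nu) p x / conv (avg_kernel nu) p x * p x.

Lemma local_density_is_derive (R : realType) (nu : R) (p : R -> R) (x : R) :
  0 < nu -> is_density p ->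
  is_derive x (1 : R) (conv (avg_kernel nu) p) (conv (avg_kernel' nu) p x).
Proof.
move=> nu0 dp; apply: (@conv_is_derive _ _ _ _ 1 nu^-1).
- exact: avg_kernel_continuous.
- by move=> z; exact: norm_avg_kernel.
- by move=> z; exact: avg_kernel_is_derive.
- exact: measurable_avg_kernel'.
- by move=> z; exact: norm_avg_kernel'.
- exact: density_integrable.
Qed.

Lemma local_moment_is_derive (R : realType) (nu : R) (p : R -> R) (x : R) :
  0 < nu -> is_density p ->
  is_derive x (1 : R) (conv (moment_kernel nu) p) (conv (moment_kernel' nu) p x).
Proof.
move=> nu0 dp; apply: (@conv_is_derive _ _ _ _ nu 2).
- exact: moment_kernel_continuous.
- by move=> z; exact: norm_moment_kernel.
- by move=> z; exact: moment_kernel_is_derive.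
- by apply: continuous_measurable_fun; exact: moment_kernel'_continuous.
- by move=> z; exact: norm_moment_kernel'.
- exact: density_integrable.
Qed.

(** The identity [K' = - m / nu] between the pair kernel and the moment kernel,
    carried through the convolution. *)
Lemma pair_potential_is_derive (R : realType) (nu : R) (p : R -> R) (x : R) :
  0 < nu -> is_density p ->
  is_derive x (1 : R) (conv (pair_kernel nu) p) (- (conv (moment_kernel nu) p x / nu)).
Proof.
move=> nu0 dp.
have -> : - (conv (moment_kernel nu) p x / nu) = conv (pair_kernel' nu) p x.
  rewrite -mulrN mulrC -invrN /conv -RintegralZl//.
    congr Rintegral; apply/funext => y; rewrite /pair_kernel'.
    by field; rewrite gt_eqF.
  apply: (integrable_conv x _ (fun z => norm_moment_kernel z nu0)).
    by apply: continuous_measurable_fun; exact: moment_kernel_continuous.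
  exact: density_integrable.
apply: (@conv_is_derive _ _ _ _ nu 1).
- exact: pair_kernel_continuous.
- by move=> z; exact: norm_pair_kernel.
- by move=> z; apply: pair_kernel_is_derive; rewrite gt_eqF.
- by apply: continuous_measurable_fun; exact: pair_kernel'_continuous.
- by move=> z; exact: norm_pair_kernel'.
- exact: density_integrable.
Qed.

Lemma pair_potential_continuous (R : realType) (nu : R) (p : R -> R) :
  0 < nu -> is_density p -> continuous (conv (pair_kernel nu) p).
Proof. by move=> nu0 dp x; exact: is_derive_continuous (pair_potential_is_derive x nu0 dp). Qed.

Lemma norm_pair_potential (R : realType) (nu : R) (p : R -> R) (x : R) :
  0 < nu -> is_density p -> `|conv (pair_kernel nu) p x| <= nu.
Proof.
move=> nu0 dp; apply: norm_conv_le => //.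
- by apply: continuous_measurable_fun; exact: pair_kernel_continuous.
- by move=> z; exact: norm_pair_kernel.
Qed.

(** Continuity of the derivative is what the fundamental theorem of calculus
    requires when it is applied to the product of [phi] and the flux. *)
Lemma flux_is_derive (R : realType) (nu : R) (p : R -> R) :
  0 < nu -> is_density p -> (forall x, derivable p x 1) -> continuous (derive1 p) ->
  (forall x, is_derive x (1 : R) (flux nu p) (derive1 (flux nu p) x)) /\
  continuous (derive1 (flux nu p)).
Proof.
move=> nu0 dp dx cdx.
set g := conv (avg_kernel nu) p; set h := conv (moment_kernel nu) p.
pose g' := conv (avg_kernel' nu) p; pose h' := conv (moment_kernel' nu) p.
have ip := density_integrable dp.
have dg x : is_derive x (1 : R) g (g' x) by exact: local_density_is_derive.
have dh x : is_derive x (1 : R) h (h' x) by exact: local_moment_is_derive.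
have g0 x : g x != 0 by rewrite gt_eqF// local_density_gt0.
have dpx x : is_derive x (1 : R) p (derive1 p x).
  by rewrite derive1E; apply: DeriveDef; [exact: dx|].
pose w' x := (h' x * (g x)^-1 + h x * (- g' x / g x ^+ 2)) * p x + h x / g x * derive1 p x.
have dw x : is_derive x (1 : R) (flux nu p) (w' x).
  exact: is_derive_mul (is_derive_mul (dh x) (is_derive_inv (g0 x) (dg x))) (dpx x).
have wE : derive1 (flux nu p) = w'.
  by apply/funext => x; rewrite derive1E; have [] := dw x.
rewrite wE; split => // x.
have cg : continuous g by move=> y; exact: is_derive_continuous (dg y).
have ch : continuous h by move=> y; exact: is_derive_continuous (dh y).
have cg' : continuous g'.
  apply: (@conv_continuous _ _ _ nu^-1) ip.
  - exact: measurable_avg_kernel'.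
  - by move=> z; exact: norm_avg_kernel'.
  - move=> z z0; change (avg_kernel' nu y @[y --> z] --> avg_kernel' nu z).
    have cdiv : avg_kernel nu y / nu @[y --> z] --> avg_kernel nu z / nu.
      by apply: cvgMl; exact: (@avg_kernel_continuous R nu z).
    have [zp|zn] := ltP 0 z.
      have -> : avg_kernel' nu z = - (avg_kernel nu z / nu) by rewrite /avg_kernel' zp.
      apply: cvg_trans; last exact: (cvgN cdiv).
      apply: near_eq_cvg; near=> y.
      by rewrite /avg_kernel' ifT//; near: y; exact: lt_nbhsr.
    have -> : avg_kernel' nu z = avg_kernel nu z / nu by rewrite /avg_kernel' ltNge zn.
    have {}zn : z < 0 by rewrite lt_neqAle z0.
    apply: cvg_trans; last exact: cdiv.
    apply: near_eq_cvg; near=> y.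
    rewrite /avg_kernel' ifF//; apply/negbTE; rewrite -leNgt ltW//.
    by near: y; exact: lt_nbhsl.
have ch' : continuous h'.
  apply: (@conv_continuous _ _ _ 2) ip.
  - by apply: continuous_measurable_fun; exact: moment_kernel'_continuous.
  - by move=> z; exact: norm_moment_kernel'.
  - by move=> z _; exact: moment_kernel'_continuous.
have [cp _ _] := dp.
have cgV : (g y)^-1 @[y --> x] --> (g x)^-1 by apply: cvgV; [exact: g0|exact: cg].
rewrite /w'; apply: cvgD; apply: cvgM.
- apply: cvgD; apply: cvgM; [exact: ch'|exact: cgV|exact: ch|].
  apply: cvgM; first by apply: cvgN; exact: cg'.
  apply: cvgV; first by rewrite expf_neq0.
  by apply: cvgM; exact: cg.
- exact: cp.
- by apply: cvgM; [exact: ch|exact: cgV].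
- exact: cdx.
Unshelve. all: by end_near. Qed.

(** Integrate by parts: [(phi w)' = phi w' + phi' w] and
    [phi' w = - (h / nu) (h / g) p], which is minus the integrand on the left divided
    by [nu]. The flux is bounded by [(1 + |x|) p] up to a constant, as
    [integral_by_cutoff] requires. *)
Lemma flux_dissipation (R : realType) (nu : R) (p : R -> R) :
  0 < nu -> is_density p -> (forall x, derivable p x 1) -> continuous (derive1 p) ->
  (@lebesgue_measure R).-integrable setT (EFin \o derive1 (flux nu p)) ->
  p x @[x --> -oo] --> (0 : R) -> p x @[x --> +oo] --> (0 : R) ->
  (\int[@lebesgue_measure R]_x
     (conv (moment_kernel nu) p x ^+ 2 / conv (avg_kernel nu) p x * p x)%:E =
   (nu * \int[@lebesgue_measure R]_x
     (conv (pair_kernel nu) p x * derive1 (flux nu p) x))%:E)%E.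
Proof.
move=> nu0 dp dx cdx iw pN pP.
have [dw cw'] := flux_is_derive nu0 dp dx cdx.
set g := conv (avg_kernel nu) p; set h := conv (moment_kernel nu) p.
set phi := conv (pair_kernel nu) p.
have [cp p0 _] := dp; have ip := density_integrable dp.
have g0 x : 0 < g x by exact: local_density_gt0.
have cphi : continuous phi by exact: pair_potential_continuous.
have cg : continuous g by move=> y; exact: is_derive_continuous (local_density_is_derive
    y nu0 dp).
have ch : continuous h by move=> y; exact: is_derive_continuous (local_moment_is_derive y nu0 dp).
pose q x := h x ^+ 2 / g x * p x / nu.
have q0 x : 0 <= q x.
  by rewrite /q divr_ge0 ?(ltW nu0)// mulr_ge0// divr_ge0 ?sqr_ge0// ltW.
have cq : continuous q.
  move=> x; apply: cvgMl; apply: cvgM; last exact: cp.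
  apply: cvgM; first by apply: cvgM; exact: ch.
  by apply: cvgV; [rewrite gt_eqF|exact: cg].
set c := 2 + 2 * nu / g 0.
have c0 : 0 <= c by rewrite addr_ge0// divr_ge0 ?mulr_ge0 ?ltW.
have bh x : `|h x| / g x <= c * (1 + `|x|).
  by rewrite ler_pdivrMr//; exact: norm_local_moment_le.
have hnu x : `|h x| <= nu.
  apply: norm_conv_le => //.
  - by apply: continuous_measurable_fun; exact: moment_kernel_continuous.
  - by move=> z; exact: norm_moment_kernel.
have x0 x : 0 <= 1 + `|x| :> R by rewrite addr_ge0.
have bw x : `|flux nu p x| <= c * (1 + `|x|) * p x.
  rewrite /flux -/g -/h !normrM normfV (gtr0_norm (g0 x)) (ger0_norm (p0 x)).
  by rewrite ler_wpM2r.
have H : (\int[@lebesgue_measure R]_x (q x)%:E =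
    (\int[@lebesgue_measure R]_x (phi x * derive1 (flux nu p) x))%:E)%E.
  apply: (@integral_by_cutoff _ (fun x => phi x * flux nu p x)
    (fun x => phi x * derive1 (flux nu p) x) q p (nu * c + c)) => //.
  - move=> x; have := is_derive_mul (pair_potential_is_derive x nu0 dp) (dw x).
    congr is_derive; rewrite /q /flux -/g -/h -/phi.
    by field; rewrite !gt_eqF.
  - by move=> x; apply: cvgM; [exact: cphi|exact: cw'].
  - apply: (@integrable_bounded_mul _ _ _ nu) iw.
      exact: continuous_measurable_fun.
    by move=> x; exact: norm_pair_potential.
  - by rewrite addr_ge0// mulr_ge0// ltW.
  - move=> x; rewrite normrM (@le_trans _ _ (nu * (c * (1 + `|x|) * p x)))//.
      by apply: ler_pM => //; exact: norm_pair_potential.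
    have -> : (nu * c + c) * (1 + `|x|) * p x = nu * (c * (1 + `|x|) * p x) + c * (1 +
        `|x|) * p x by ring.
    by rewrite lerDl !mulr_ge0.
  - move=> x; have -> : q x = `|h x| / nu * (`|h x| / g x) * p x.
      by rewrite /q -(real_normK (num_real (h x))); field; rewrite !gt_eqF.
    rewrite ler_wpM2r// (@le_trans _ _ (1 * (c * (1 + `|x|))))//.
      by apply: ler_pM => //; rewrite ?divr_ge0 ?(ltW nu0) ?(ltW (g0 x))// ler_pdivrMr// mul1r.
    by rewrite mul1r ler_wpM2r// lerDr mulr_ge0// ltW.
rewrite EFinM -H -ge0_integralZl//.
- by apply: eq_integral => x _; rewrite -EFinM; congr EFin; rewrite /q; field; rewrite !gt_eqF.
- by apply/measurable_EFinP; exact: continuous_measurable_fun.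
- by move=> x _; rewrite lee_fin.
- by rewrite lee_fin ltW.
Qed.

(** * The dissipation is positive *)

(** If the integral vanished, then [h p] would vanish almost everywhere, and the
    integral of [psi h p] would be 0 for every bounded [psi]. But the moment kernel
    is odd, so symmetrising that integral in its two variables gives half the
    integral of [(psi x - psi y) m (x - y) p x p y], and this is positive when [psi] is
    strictly increasing. *)
Lemma dissipation_gt0 (R : realType) (nu : R) (p : R -> R) :
  0 < nu -> is_density p ->
  (0 < \int[@lebesgue_measure R]_x
     (conv (moment_kernel nu) p x ^+ 2 / conv (avg_kernel nu) p x * p x)%:E)%E.
Proof.
move=> nu0 dp; have [cp p0 p1] := dp; have ip := density_integrable dp.
have mp := density_measurable dp.
set g := conv (avg_kernel nu) p; set h := conv (moment_kernel nu) p.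
have g0 x : 0 < g x by exact: local_density_gt0.
have mg : measurable_fun setT g.
  by apply: continuous_measurable_fun => x; exact: is_derive_continuous
      (local_density_is_derive x nu0 dp).
have mh : measurable_fun setT h.
  by apply: continuous_measurable_fun => x; exact: is_derive_continuous
      (local_moment_is_derive x nu0 dp).
have gV : measurable_fun setT (fun x => (g x)^-1).
  apply: continuous_measurable_fun => x; apply: cvgV; first by rewrite gt_eqF.
  exact: is_derive_continuous (local_density_is_derive x nu0 dp).
have mm := continuous_measurable_fun (@moment_kernel_continuous R nu).
have mC z := @norm_moment_kernel R nu z nu0.
have diss0 x : 0 <= h x ^+ 2 / g x * p x.
  by rewrite mulr_ge0// divr_ge0 ?sqr_ge0// ltW.
have hE x : h x = \int[@lebesgue_measure R]_y (moment_kernel nu (x - y) * p y) by [].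
have ch : continuous h.
  by move=> x; exact: is_derive_continuous (local_moment_is_derive x nu0 dp).
have hnu x : `|h x| <= nu by exact: norm_conv_le.
clearbody g h.
rewrite lt_neqAle integral_ge0 ?andbT; last by move=> x _; rewrite lee_fin.
apply/eqP => D0.
(* Any bounded, continuous and strictly increasing function would do. *)
pose psi (x : R) : R := - (1 + expR x)^-1.
have cpsi : continuous psi.
  move=> x; apply: cvgN; apply: cvgV; first by rewrite gt_eqF// addr_gt0// expR_gt0.
  by apply: cvgD; [exact: cvg_cst|exact: continuous_expR].
have mpsi := continuous_measurable_fun cpsi.
have psi1 x : `|psi x| <= 1.
  rewrite normrN gtr0_norm ?invr_gt0 ?addr_gt0 ?expR_gt0//.
  by rewrite invf_le1 ?addr_gt0 ?expR_gt0// lerDl expR_ge0.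
have psi_incr x y : x < y -> psi x < psi y.
  move=> xy; rewrite ltrN2 ltf_pV2 ?posrE ?addr_gt0 ?expR_gt0//.
  by rewrite ltrD2l ltr_expR.
have ipsip : (@lebesgue_measure R).-integrable setT (EFin \o (fun x => psi x * p x)).
  exact: integrable_bounded_mul psi1 ip.
(* The half of the symmetrised integral in which [psi] carries the inner variable. *)
pose h2 := conv (moment_kernel nu) (fun x => psi x * p x).
have ch2 : continuous h2.
  by apply: (conv_continuous mm mC _ ipsip) => z _; exact: moment_kernel_continuous.
have h2E x : h2 x = \int[@lebesgue_measure R]_y (moment_kernel nu (x - y) * (psi y * p y)) by [].
have h2nu x : `|h2 x| <= nu.
  have ipsix := integrable_conv x mm mC ipsip.
  rewrite h2E (le_trans (le_normr_Rintegral measurableT ipsix))//.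
  have nuE : nu = \int[@lebesgue_measure R]_y (nu * p y).
    by rewrite RintegralZl// /Rintegral p1 mulr1.
  rewrite [leRHS]nuE; apply: le_Rintegral => //.
  - exact: integrable_norm ipsix.
  - exact: integrable_scale ip.
  - move=> y _; rewrite !normrM (ger0_norm (p0 y)); apply: ler_pM => //.
    - by rewrite mulr_ge0.
    - by rewrite -normrM; exact: mC.
    - by rewrite ler_piMl.
clearbody h2.
have ii : (@lebesgue_measure R).-integrable setT (EFin \o (fun x => psi x * p x * h x)).
  have := @integrable_bounded_mul _ h (fun x => psi x * p x) nu mh hnu ipsip.
  by apply: eq_integrable => // x _; rewrite /= mulrC.
have ii2 : (@lebesgue_measure R).-integrable setT (EFin \o (fun x => h2 x * p x)).
  exact: integrable_bounded_mul (continuous_measurable_fun ch2) h2nu ip.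
have J1 : \int[@lebesgue_measure R]_x (psi x * p x * h x) = 0.
  have m1 : measurable_fun setT (fun x => psi x * p x * h x).
    by apply: measurable_funM => //; exact: measurable_funM.
  have : (\int[@lebesgue_measure R]_x `|psi x * p x * h x|%:E = 0)%E.
    apply: (@integral_abs_eq0_transfer _ (fun x => h x ^+ 2 / g x * p x) _ 0) => //.
    - apply: measurable_funM => //; apply: measurable_funM => //.
      exact: measurable_funM.
    - move=> x _ /eqP; rewrite !mulf_eq0 invr_eq0 (gt_eqF (g0 x)) orbF orbb.
      by move=> /orP[|] /eqP ->; rewrite ?mulr0 ?mul0r.
    - by rewrite [RHS]D0; apply: eq_integral => x _; rewrite ger0_norm.
  move=> abs0; apply/eqP; rewrite -normr_le0.
  by rewrite (le_trans (le_normr_Rintegral measurableT ii))// /Rintegral abs0.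
have inner y : \int[@lebesgue_measure R]_x (moment_kernel nu (x - y) * (psi x * p x)) = -1 * h2 y.
  rewrite h2E -RintegralZl//; last exact: (integrable_conv y mm mC ipsip).
  congr Rintegral; apply/funext => x.
  by rewrite -(opprB y) moment_kernelN; ring.
have J2 : \int[@lebesgue_measure R]_x (h2 x * p x) = 0.
  have mP : measurable_fun setT (fun z : R * R => moment_kernel nu (z.1 - z.2)).
    apply: measurableT_comp mm _.
    by apply: measurable_funB; [exact: measurable_fst|exact: measurable_snd].
  have := @Fubini_bounded_kernel _ (fun z : R * R => moment_kernel nu (z.1 - z.2))
    (fun x => psi x * p x) p nu mP (fun z => mC _) ipsip ip.
  under eq_Rintegral do rewrite /= -hE.
  rewrite J1; under eq_Rintegral do rewrite /= inner mulrCA (mulrC (p _)).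
  by rewrite RintegralZl// mulN1r => /eqP; rewrite eq_sym oppr_eq0 => /eqP.
(* The inner integral of the symmetrised form: the kernel
   [(psi x - psi y) m (x - y)] is positive off the diagonal. *)
pose w x := psi x * h x - h2 x.
have w_gt0 x : 0 < w x.
  have mk : measurable_fun setT (fun y : R => (psi x - psi y) * moment_kernel nu (x - y)).
    by apply: measurable_funM; [exact: measurable_funB|exact: measurable_translate].
  have kpos y : y != x -> 0 < (psi x - psi y) * moment_kernel nu (x - y).
    rewrite neq_lt => /orP[yx|xy]; rewrite /moment_kernel mulrA mulr_gt0 ?avg_kernel_gt0//.
      by rewrite mulr_gt0 ?subr_gt0// psi_incr.
    by rewrite nmulr_rgt0 ?subr_lt0// psi_incr.
  have k0 y : 0 <= (psi x - psi y) * moment_kernel nu (x - y).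
    by have [->|/kpos/ltW//] := eqVneq y x; rewrite subrr mul0r.
  have := @weighted_integral_gt0 _ _ p x dp mk k0 kpos.
  have i1 := integrable_conv x mm mC ip; have i2 := integrable_conv x mm mC ipsip.
  have i1Z : (@lebesgue_measure R).-integrable setT (EFin \o (fun y => psi x *
      (moment_kernel nu (x - y) * p y))).
    exact: integrable_scale i1.
  have -> : w x = \int[@lebesgue_measure R]_y ((psi x - psi y) * moment_kernel nu (x - y) * p y).
    rewrite /w hE h2E -RintegralZl// -RintegralB//.
    by congr Rintegral; apply/funext => y; ring.
  rewrite /Rintegral -lte_fin fineK//.
  have := integrableB measurableT i1Z i2 => /(integrable_fin_num measurableT).
  by congr (_ \is a fin_num); apply: eq_integral => y _; rewrite /= -EFinB; congr EFin; ring.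
have mw : measurable_fun setT w.
  by apply: measurable_funB; [exact: measurable_funM|exact: continuous_measurable_fun].
have := @weighted_integral_gt0 _ w p 0 dp mw (fun x => ltW (w_gt0 x)) (fun x _ => w_gt0 x).
have iw : (@lebesgue_measure R).-integrable setT (EFin \o (fun x => w x * p x)).
  have := integrableB measurableT ii ii2.
  by apply: eq_integrable => // x _; rewrite /= -EFinB; congr EFin; rewrite /w; ring.
rewrite -[X in (_ < X)%E]fineK; last exact: integrable_fin_num iw.
suff -> : fine (\int[@lebesgue_measure R]_x (w x * p x)%:E) = 0 by rewrite ltxx.
transitivity (\int[@lebesgue_measure R]_x (psi x * p x * h x - h2 x * p x)).
  by congr Rintegral; apply/funext => x; rewrite /w; ring.
by rewrite RintegralB// J1 J2 subrr.
Qed.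

(** * Time derivative of the pair energy *)

(** At positive times the constraint [0 <= s] is void near [t]. *)
Lemma time_quotient_interior (R : realType) (u : R -> R) (t : R) : 0 < t ->
  time_derivable u t -> is_derive t (1 : R) u (time_derive u t).
Proof.
move=> t0 du.
have cq : (u s - u t) / (s - t) @[s --> within [set s : R | 0 <= s] t^'] --> time_derive u t.
  exact: du.
suff H : h^-1 *: (u (h *: 1 + t) - u t) @[h --> 0^'] --> time_derive u t.
  by apply: DeriveDef; [apply/cvg_ex; exists (time_derive u t)|apply/cvg_lim].
apply/cvgrPdist_lt => e e0.
move/cvgrPdist_lt : cq => /(_ e e0) [d /= d0 dq].
near=> h.
have h0 : h != 0 by near: h; exact: nbhs_dnbhs_neq.
have hm : `|h| < Num.min d t.
  near: h; apply: dnbhs0_lt; by rewrite lt_min d0.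
move: hm; rewrite lt_min => /andP[hd ht].
have := dq (h + t).
rewrite /= opprD addrCA subrr addr0 normrN addrK => /(_ hd).
rewrite -subr_eq0 addrK h0 => /(_ isT).
have -> : 0 <= h + t by have := ler_norm (- h); rewrite normrN; lra.
by move=> /(_ isT); rewrite /GRing.scale/= mulr1 mulrC.
Unshelve. all: by end_near. Qed.

Lemma time_derivable_continuous (R : realType) (u : R -> R) (t : R) :
  time_derivable u t -> u s @[s --> within [set s : R | 0 <= s] t^'] --> u t.
Proof.
move=> du.
have cq : (u s - u t) / (s - t) @[s --> within [set s : R | 0 <= s] t^'] --> time_derive u t.
  exact: du.
have cs : s @[s --> within [set s : R | 0 <= s] t^'] --> t.
  by apply: cvg_trans (cvg_within _) _; exact: cvg_within.
have : u t + (u s - u t) / (s - t) * (s - t) @[s --> within [set s : R | 0 <= s] t^'] -->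
    u t + time_derive u t * (t - t).
  apply: cvgD; first exact: cvg_cst.
  by apply: cvgM => //; apply: cvgB => //; exact: cvg_cst.
rewrite subrr mulr0 addr0; apply: cvg_trans; apply: near_eq_cvg.
near=> s; have st : s != t by near: s; exists 1 => //= ? _ ->.
by rewrite divfK ?subr_eq0// addrC subrK.
Unshelve. all: by end_near. Qed.

(** Continuity at the end points is all that the mean value theorem asks there, so
    the one-sided derivative at time 0 suffices. *)
Lemma time_mean_value (R : realType) (u : R -> R) (M a b : R) :
  0 <= a -> a <= b -> (forall r, 0 <= r -> time_derivable u r) ->
  (forall r, a <= r <= b -> `|time_derive u r| <= M) ->
  `|u b - u a| <= M * (b - a).
Proof.
move=> a0; rewrite le_eqVlt => /predU1P[->|ab] du bM; first by rewrite !subrr normr0 mulr0.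
have [||c cab ->] := @MVT _ u (time_derive u) a b ab.
- move=> x; rewrite in_itv/= => /andP[ax xb].
  by apply: time_quotient_interior; [lra|apply: du; lra].
- apply/continuous_within_itvP => //; split.
  + move=> x; rewrite in_itv/= => /andP[ax xb].
    apply: (@is_derive_continuous _ _ _ (time_derive u x)).
    by apply: time_quotient_interior; [lra|apply: du; lra].
  + have := time_derivable_continuous (du _ a0); apply: cvg_trans.
    move=> A; rewrite /nbhs/= => -[d /= d0 dA]; exists d => //= s sd sa.
    apply: (dA s sd); first by rewrite gt_eqF.
    by rewrite /=; lra.
  + apply: cvg_at_left_filter.
    apply: (@is_derive_continuous _ _ _ (time_derive u b)).
    by apply: time_quotient_interior; [lra|apply: du; lra].
- move: cab; rewrite in_itv/= => /andP[ac cb].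
  rewrite normrM (gtr0_norm (_ : 0 < b - a)) ?subr_gt0// ler_wpM2r ?subr_ge0 ?(ltW ab)//.
  by apply: bM; rewrite !ltW.
Qed.

Lemma time_lipschitz (R : realType) (u : R -> R) (M e t s : R) :
  0 <= t -> 0 <= s -> `|s - t| < e -> (forall r, 0 <= r -> time_derivable u r) ->
  (forall r, 0 <= r -> `|r - t| < e -> `|time_derive u r| <= M) ->
  `|u s - u t| <= M * `|s - t|.
Proof.
move=> t0 s0 ste du bM.
have [ts|/ltW st] := leP t s.
  rewrite (ger0_norm (_ : 0 <= s - t)) ?subr_ge0//.
  apply: time_mean_value => // r /andP[tr rs]; apply: bM; first lra.
  by move: ste; rewrite !ger0_norm ?subr_ge0//; lra.
rewrite distrC (distrC s) (ger0_norm (_ : 0 <= t - s)) ?subr_ge0//.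
apply: time_mean_value => // r /andP[sr rt]; apply: bM; first lra.
by move: ste; rewrite distrC (distrC r) !ger0_norm ?subr_ge0//; lra.
Qed.

(** The double integral of [K (x - y) p x p y]. *)
Definition energy (R : realType) (nu : R) (p : R -> R) : R :=
  \int[@lebesgue_measure R]_y (conv (pair_kernel nu) p y * p y).

(** A symmetric bilinear form satisfies
    [B p p - B q q = B (p + q) (p - q)]. *)
Lemma energy_difference (R : realType) (nu : R) (p q : R -> R) :
  0 < nu -> is_density p -> is_density q ->
  energy nu p - energy nu q =
  \int[@lebesgue_measure R]_y
    ((conv (pair_kernel nu) p y + conv (pair_kernel nu) q y) * (p y - q y)).
Proof.
move=> nu0 dp dq; have ip := density_integrable dp; have iq := density_integrable dq.
have mK := continuous_measurable_fun (@pair_kernel_continuous R nu).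
have KC z := @norm_pair_kernel R nu z nu0.
have int a b : is_density a -> is_density b -> (@lebesgue_measure R).-integrable setT
    (EFin \o (fun y => conv (pair_kernel nu) a y * b y)).
  move=> da db; apply: (@integrable_bounded_mul _ _ _ nu); last exact: density_integrable.
    by apply: continuous_measurable_fun; exact: pair_potential_continuous.
  by move=> x; exact: norm_pair_potential.
have cross : \int[@lebesgue_measure R]_y (conv (pair_kernel nu) p y * q y) =
    \int[@lebesgue_measure R]_y (conv (pair_kernel nu) q y * p y).
  have mP : measurable_fun setT (fun z : R * R => pair_kernel nu (z.1 - z.2)).
    apply: measurableT_comp mK _.
    by apply: measurable_funB; [exact: measurable_fst|exact: measurable_snd].
  have := @Fubini_bounded_kernel _ (fun z : R * R => pair_kernel nu (z.1 - z.2))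
    q p nu mP (fun z => KC _) iq ip.
  under eq_Rintegral do rewrite mulrC.
  move=> ->; apply: eq_Rintegral => y _; rewrite mulrC; congr (_ * _).
  by apply: eq_Rintegral => x _; rewrite /= -(pair_kernelN _ (x - y)) opprB.
have split : \int[@lebesgue_measure R]_y
    ((conv (pair_kernel nu) p y + conv (pair_kernel nu) q y) * (p y - q y)) =
  \int[@lebesgue_measure R]_y
    ((conv (pair_kernel nu) p y * p y - conv (pair_kernel nu) q y * q y) +
     (conv (pair_kernel nu) q y * p y - conv (pair_kernel nu) p y * q y)).
  by apply: eq_Rintegral => y _; ring.
rewrite split RintegralD//; [|exact: integrable_sub (int _ _ dp dp) (int _ _ dq
    dq)|exact: integrable_sub (int _ _ dq dp) (int _ _ dp dq)].
rewrite (RintegralB measurableT (int _ _ dp dp) (int _ _ dq dq)).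
by rewrite (RintegralB measurableT (int _ _ dq dp) (int _ _ dp dq)) cross subrr addr0.
Qed.

Lemma pair_potential_lipschitz (R : realType) (nu c y : R) (p q G : R -> R) :
  0 < nu -> is_density p -> is_density q ->
  (@lebesgue_measure R).-integrable setT (EFin \o G) ->
  (forall x, `|p x - q x| <= G x * c) ->
  `|conv (pair_kernel nu) p y - conv (pair_kernel nu) q y| <=
    nu * (\int[@lebesgue_measure R]_x G x) * c.
Proof.
move=> nu0 dp dq iG pq.
have ip := density_integrable dp; have iq := density_integrable dq.
have mK := continuous_measurable_fun (@pair_kernel_continuous R nu).
have KC z := @norm_pair_kernel R nu z nu0.
have i1 := integrable_conv y mK KC ip; have i2 := integrable_conv y mK KC iq.
rewrite /conv -RintegralB//.
have iB : (@lebesgue_measure R).-integrable setT (EFin \o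
    (fun x => pair_kernel nu (y - x) * p x - pair_kernel nu (y - x) * q x)).
  exact: integrable_sub i1 i2.
rewrite (le_trans (le_normr_Rintegral measurableT iB))//.
have iGZ : (@lebesgue_measure R).-integrable setT (EFin \o (fun x => (nu * c) * G x)).
  exact: integrable_scale iG.
have -> : nu * (\int[@lebesgue_measure R]_x G x) * c = \int[@lebesgue_measure R]_x ((nu *
    c) * G x).
  by rewrite RintegralZl//; ring.
apply: le_Rintegral => //; first exact: integrable_norm iB.
move=> x _; rewrite -mulrBr normrM -mulrA (mulrC c).
by apply: ler_pM => //; exact: KC.
Qed.

(** By [energy_difference] the difference quotient of the energy is the integral of
    [phi_s + phi_t] times the difference quotient of [f], which the mean value
    inequality dominates by [2 nu G]; and [phi_s] tends to [phi_t] pointwise because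
    the densities converge in [L^1]. *)
Lemma energy_time_derivative (R : realType) (nu t e : R) (f : R -> R -> R) (G : R -> R) :
  0 < nu -> 0 <= t -> 0 < e ->
  (forall s, 0 <= s -> is_density (f ^~ s)) ->
  (forall x s, 0 <= s -> time_derivable (f x) s) ->
  (@lebesgue_measure R).-integrable setT (EFin \o G) ->
  (forall s x, 0 <= s -> `|s - t| < e -> `|time_derive (f x) s| <= G x) ->
  measurable_fun setT (fun x => time_derive (f x) t) ->
  time_quotient (fun s => energy nu (f ^~ s)) t -->
    2 * \int[@lebesgue_measure R]_y
      (conv (pair_kernel nu) (f ^~ t) y * time_derive (f y) t).
Proof.
move=> nu0 t0 e0 df td iG bG mft.
pose D := [set s : R | 0 <= s].
pose phi s := conv (pair_kernel nu) (f ^~ s).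
have mG : measurable_fun setT G by apply/measurable_EFinP; apply: measurable_int iG.
have mphi s : 0 <= s -> measurable_fun setT (phi s).
  by move=> s0; apply: continuous_measurable_fun; apply: pair_potential_continuous => //;
      exact: df.
have lip s x : 0 <= s -> `|s - t| < e -> `|f x s - f x t| <= G x * `|s - t|.
  move=> s0 se; apply: (@time_lipschitz _ (f x) (G x) e) => //.
    by move=> r r0; exact: td.
  by move=> r r0 re; exact: bG.
have near_e : \forall s \near within D t^', `|s - t| < e.
  by exists e => //= s; rewrite distrC => ? _ _.
have near_D : \forall s \near within D t^', 0 <= s by exact: near_withinT.
have near_t : \forall s \near within D t^', s != t.
  by exists 1 => //= s _ ->.
have phi_cvg y : phi s y @[s --> within D t^'] --> phi t y.
  have cs : s @[s --> within D t^'] --> t.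
    by apply: cvg_trans (cvg_within _) _; exact: cvg_within.
  have cn : nu * (\int[@lebesgue_measure R]_x G x) * `|s - t| @[s --> within D t^'] --> (0 : R).
    rewrite -[X in _ --> X](mulr0 (nu * (\int[@lebesgue_measure R]_x G x))); apply: cvgMr.
    rewrite -(normr0 R); apply: cvg_norm; rewrite -(subrr t).
    by apply: cvgB => //; exact: cvg_cst.
  have cd : phi s y - phi t y @[s --> within D t^'] --> (0 : R).
    apply/norm_cvg0P; apply: (@squeeze_cvgr _ _ _ _ (cst 0) (fun s => nu *
        (\int[@lebesgue_measure R]_x G x) * `|s - t|)).
    - near=> s; rewrite normr_ge0/=.
      have s0 : 0 <= s by near: s.
      apply: pair_potential_lipschitz => //; [exact: df|exact: df|].
      by move=> x; apply: lip => //; near: s.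
    - exact: cvg_cst.
    - exact: cn.
  have : phi s y - phi t y + phi t y @[s --> within D t^'] --> 0 + phi t y.
    by apply: cvgD => //; exact: cvg_cst.
  rewrite add0r; apply: cvg_trans; apply: near_eq_cvg.
  by apply: nearW => s /=; rewrite subrK.
have quotE s : 0 <= s -> (energy nu (f ^~ s) - energy nu (f ^~ t)) / (s - t) =
    \int[@lebesgue_measure R]_y ((phi s y + phi t y) * ((f y s - f y t) / (s - t))).
  move=> s0; rewrite energy_difference//; [|exact: df|exact: df].
  rewrite -RintegralZr//.
    by apply: eq_Rintegral => y _; rewrite mulrA.
  have ids := density_integrable (df s s0); have idt := density_integrable (df t t0).
  apply: (@integrable_bounded_mul _ _ _ (nu + nu)).
  - by apply: measurable_funD; exact: mphi.
  - move=> y; rewrite (le_trans (ler_normD _ _))// lerD// norm_pair_potential//; exact: df.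
  - exact: integrable_sub ids idt.
rewrite /time_quotient -/D.
have -> : 2 * \int[@lebesgue_measure R]_y (phi t y * time_derive (f y) t) =
    \int[@lebesgue_measure R]_y ((phi t y + phi t y) * time_derive (f y) t).
  rewrite -RintegralZl//.
    by apply: eq_Rintegral => y _; ring.
  apply: (@integrable_bounded_mul _ _ _ nu); [exact: mphi| |].
    by move=> y; apply: norm_pair_potential => //; exact: df.
  by apply: integrable_bound iG _ => // x; apply: bG => //; rewrite subrr normr0.
have quot_eq : \forall s \near within D t^',
    \int[@lebesgue_measure R]_y ((phi s y + phi t y) * ((f y s - f y t) / (s - t))) =
    (energy nu (f ^~ s) - energy nu (f ^~ t)) / (s - t).
  by near=> s; rewrite quotE//; near: s.
apply: cvg_trans (near_eq_cvg quot_eq) _.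
apply: (@dominated_within _ D t 0 (fun s y => (phi s y + phi t y) * ((f y s - f y t) / (s - t)))
  (fun y => (phi t y + phi t y) * time_derive (f y) t) (fun y => (nu + nu) * G y)).
- move=> s Ds st; apply: measurable_funM.
    by apply: measurable_funD; exact: mphi.
  apply: measurable_funM => //; apply: measurable_funB; apply: density_measurable; exact: df.
- by apply: measurable_funM => //; apply: measurable_funD; exact: mphi.
- exact: integrable_scale iG.
- near=> s => y.
  have s0 : 0 <= s by near: s.
  have st : s != t by near: s.
  have se : `|s - t| < e by near: s.
  rewrite normrM ler_pM//.
    by rewrite (le_trans (ler_normD _ _))// lerD// norm_pair_potential//; exact: df.
  by rewrite normrM normfV ler_pdivrMr ?normr_gt0 ?subr_eq0// lip.
- move=> y _; apply: cvgM; last exact: (td y t t0).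
  by apply: cvgD; [exact: phi_cvg|exact: cvg_cst].
Unshelve. all: by end_near. Qed.

(** * The squared norm of the local average *)

(** Limits along this filter are therefore unique, also at time 0. *)
Lemma half_line_dnbhs_proper (R : realType) (t : R) : 0 <= t ->
  ProperFilter (within [set s : R | 0 <= s] t^').
Proof.
move=> t0; apply: Build_ProperFilter_ex => P [d /= d0 dP].
exists (t + d / 2); apply: dP => /=.
- by rewrite opprD addrA subrr sub0r normrN gtr0_norm; lra.
- by rewrite gt_eqF//; lra.
- by lra.
Qed.

(** Finiteness excludes the junk value that [fine] gives to an infinite norm. *)
Lemma sqr_L2norm (R : realType) (u : R -> R) :
  (\int[@lebesgue_measure R]_x (u x ^+ 2)%:E < +oo)%E ->
  L2norm u ^+ 2 = \int[@lebesgue_measure R]_x (u x ^+ 2).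
Proof.
move=> fin; rewrite /L2norm /Rintegral.
have := @poweR_Lnorm _ _ _ (@lebesgue_measure R) (EFin \o u) 2 (ltac:(by rewrite pnatr_eq0)).
under eq_integral do rewrite /= powR_mulrn// real_normK ?num_real//.
have := Lnorm_ge0 (@lebesgue_measure R) 2%:E (EFin \o u).
move: fin; case: (Lnorm _ _ _) => [r| |] //= fin r0 E.
- by rewrite -E /= powR_mulrn.
- by move: fin; rewrite -E /= pnatr_eq0.
Qed.

Theorem mainTheorem2 (R : realType) (nu : R) (f g h : R -> R -> R)
  (nu_gt0 : 0 < nu)
  (f_ge0 : forall x t : R, 0 <= t -> 0 <= f x t)
  (f_smooth : sufficiently_smooth f)
  (f_mass : forall t : R, 0 <= t ->
     (\int[@lebesgue_measure R]_x (f x t)%:E = 1)%E)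
  (f_ninfty : forall t : R, 0 <= t -> f x t @[x --> -oo] --> (0 : R))
  (f_pinfty : forall t : R, 0 <= t -> f x t @[x --> +oo] --> (0 : R))
  (g_def : forall x t : R, 0 <= t -> g x t = local_average nu f x t)
  (h_def : forall x t : R, 0 <= t -> h x t = local_moment nu f x t)
  (hx_ninfty : forall t : R, 0 <= t ->
     derive1 (fun y : R => h y t) x @[x --> -oo] --> (0 : R))
  (g_ninfty : forall t : R, 0 <= t -> g x t @[x --> -oo] --> (0 : R))
  (f_evol : forall x t : R, 0 <= t ->
     time_derive (f x) t = derive1 (fun y : R => h y t / g y t * f y t) x) :
  forall t : R, 0 <= t ->
    [/\ time_derivable (fun s : R => L2norm (fun x : R => g x s) ^+ 2) t,
        ((time_derive (fun s : R => L2norm (fun x : R => g x s) ^+ 2) t)%:E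
         = (2 / nu)%:E *
           \int[@lebesgue_measure R]_x (h x t ^+ 2 / g x t * f x t)%:E)%E
      & 0 < time_derive (fun s : R => L2norm (fun x : R => g x s) ^+ 2) t].
Proof.
have [dfx cdfx dft dom] := f_smooth.
have df s : 0 <= s -> is_density (f ^~ s).
  move=> s0; split; [|by move=> x; exact: f_ge0|exact: f_mass].
  by move=> x; apply/differentiable_continuous/derivable1_diffP; exact: dfx.
have mk := continuous_measurable_fun (@avg_kernel_continuous R nu).
have mm := continuous_measurable_fun (@moment_kernel_continuous R nu).
have gE x s : 0 <= s -> g x s = conv (avg_kernel nu) (f ^~ s) x.
  by move=> s0; rewrite g_def// -conv_reflection//; exact: density_measurable (df s s0).
have hE x s : 0 <= s -> h x s = conv (moment_kernel nu) (f ^~ s) x.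
  by move=> s0; rewrite h_def// -conv_reflection//; exact: density_measurable (df s s0).
have EE s : 0 <= s -> L2norm (fun x => g x s) ^+ 2 = energy nu (f ^~ s).
  move=> s0; have ds := df s s0.
  have -> : (fun x => g x s) = conv (avg_kernel nu) (f ^~ s) by apply/funext => x; exact: gE.
  have sq := integral_sqr_local_density nu_gt0 ds.
  rewrite sqr_L2norm /Rintegral sq//.
  have : (@lebesgue_measure R).-integrable setT
      (EFin \o (fun y => conv (pair_kernel nu) (f ^~ s) y * f y s)).
    apply: (@integrable_bounded_mul _ _ _ nu); last exact: density_integrable ds.
      by apply: continuous_measurable_fun; exact: pair_potential_continuous.
    by move=> x; exact: norm_pair_potential.
  by move=> /(integrable_fin_num measurableT); rewrite fin_numE => /andP[_]; rewrite -ltey.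
move=> t t0; have dt := df t t0.
have [e [G [e0 iG bG]]] := dom t t0.
have evol x : time_derive (f x) t = derive1 (flux nu (f ^~ t)) x.
  rewrite f_evol//; congr (derive1 _ x); apply/funext => y.
  by rewrite /flux hE// gE.
have evolE : (fun x => time_derive (f x) t) = derive1 (flux nu (f ^~ t)) by apply/funext.
have [_ cw'] := flux_is_derive nu_gt0 dt (fun x => dfx t x t0) (cdfx t t0).
have mw' := continuous_measurable_fun cw'.
have iw' : (@lebesgue_measure R).-integrable setT (EFin \o derive1 (flux nu (f ^~ t))).
  apply: integrable_bound mw' iG _ => x.
  by rewrite -evol; apply: bG => //; rewrite subrr normr0.
have diss := flux_dissipation nu_gt0 dt (fun x => dfx t x t0) (cdfx t t0) iw' (f_ninfty t
    t0) (f_pinfty t t0).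
have pos := dissipation_gt0 nu_gt0 dt.
pose I := \int[@lebesgue_measure R]_x
  (conv (pair_kernel nu) (f ^~ t) x * derive1 (flux nu (f ^~ t)) x).
rewrite -/I in diss.
have I0 : 0 < I by move: pos; rewrite diss lte_fin pmulr_rgt0.
have quot : time_quotient (fun s : R => L2norm (fun x : R => g x s) ^+ 2) t --> 2 * I.
  have IE : I = \int[@lebesgue_measure R]_x
      (conv (pair_kernel nu) (f ^~ t) x * time_derive (f x) t).
    by apply: eq_Rintegral => x _; rewrite evol.
  have : time_quotient (fun s => energy nu (f ^~ s)) t --> 2 * I.
    have mft : measurable_fun setT (fun x => time_derive (f x) t) by rewrite evolE.
    rewrite IE.
    exact: (@energy_time_derivative R nu t e f G nu_gt0 t0 e0 df (fun x s => dft s x) iG bG mft).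
  apply: cvg_trans; apply: near_eq_cvg.
  have L2E s : 0 <= s -> (energy nu (f ^~ s) - energy nu (f ^~ t)) / (s - t) =
      (L2norm (fun x => g x s) ^+ 2 - L2norm (fun x => g x t) ^+ 2) / (s - t).
    by move=> s0; rewrite (EE s s0) (EE t t0).
  by exists 1; [exact: ltr01|move=> s _ _ s0; exact: L2E].
clearbody I.
have derE : time_derive (fun s : R => L2norm (fun x : R => g x s) ^+ 2) t = 2 * I.
  have FF := half_line_dnbhs_proper t0.
  by rewrite /time_derive; apply/cvg_lim.
split.
- by apply/cvg_ex; exists (2 * I).
- rewrite derE.
  have -> : (\int[@lebesgue_measure R]_x (h x t ^+ 2 / g x t * f x t)%:E = (nu * I)%:E)%E.
    by rewrite -diss; apply: eq_integral => x _; rewrite hE// gE.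
  by rewrite -EFinM; congr EFin; field; rewrite gt_eqF.
- by rewrite derE mulr_gt0.
Qed.
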